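(* Let $\Gamma=(V,E)$ be a graph product graph with vertex labeling $\varphi$, and let $G(\Gamma)$ be the corresponding graph product. If $\Gamma$ has no induced cycle of length $>3$, then $G(\Gamma)$ is coherent.
   Context: A group is coherent if every finitely generated subgroup of it is finitely presented. A graph product graph is a finite simplicial (undirected, no loops, no multiple edges) graph $\Gamma=(V,E)$ with $V\neq\emptyset$, together with a vertex labeling $\varphi$ assigning to each $v\in V$ a non-trivial finitely generated abelian group $\varphi(v)$ (all edges carry the label $2$). The graph product $G(\Gamma)$ is the group obtained from the free product of the groups $\varphi(v)$, $v\in V$, by adding the relations $[g,h]=1$ for all $g\in\varphi(v)$, $h\in\varphi(w)$ whenever $\{v,w\}\in E$. An induced subgraph of $\Gamma$ is a subgraph containing all edges of $\Gamma$ between its vertices; an induced cycle of length $n$ is an induced subgraph that is a cycle with $n$ vertices. *)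

(* Defs.v *)
From HB Require Import structures.
From mathcomp Require Import all_boot.
From mathcomp Require Import boolp classical_sets.

Set Implicit Arguments.
Unset Strict Implicit.
Unset Printing Implicit Defensive.

Local Open Scope classical_set_scope.
Local Open Scope quotient_scope.
Local Open Scope group_scope.

(* Group presentations.  A letter (x, false) stands for the generator x and   *)
(* (x, true) for its inverse.                                                 *)
Definition word (X : Type) := seq (X * bool).

Definition word_inv (X : Type) (w : word X) : word X :=
  rev [seq (l.1, ~~ l.2) | l <- w].

(* The congruence on words whose quotient is F(X) / <<R>>: [weq_cancel] gives *)
(* the free group on X, [weq_rel] kills the normal closure of R.              *)
Inductive word_eq (X : Type) (R : set (word X)) : word X -> word X -> Prop :=
| weq_refl w : word_eq R w w
| weq_sym u v : word_eq R u v -> word_eq R v u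
| weq_trans u v w : word_eq R u v -> word_eq R v w -> word_eq R u w
| weq_cat u u' v v' :
    word_eq R u u' -> word_eq R v v' -> word_eq R (u ++ v) (u' ++ v')
| weq_cancel x b : word_eq R [:: (x, b); (x, ~~ b)] [::]
| weq_rel r : R r -> word_eq R r [::].

Section PresentedGroup.
Variables (X : choiceType) (R : set (word X)).
Implicit Types u v w : word X.

Definition word_eqb : rel (word X) := fun u v => `[< word_eq R u v >].

Lemma word_eqb_refl : reflexive word_eqb.
Proof. by move=> w; apply/asboolP/weq_refl. Qed.

Lemma word_eqb_sym : symmetric word_eqb.
Proof. by move=> u v; apply/asboolP/asboolP; apply: weq_sym. Qed.

Lemma word_eqb_trans : transitive word_eqb.
Proof. by move=> v u w /asboolP uv /asboolP vw; apply/asboolP/(weq_trans uv). Qed.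

Canonical word_equiv :=
  EquivRel word_eqb word_eqb_refl word_eqb_sym word_eqb_trans.

Definition presented := {eq_quot word_equiv}.
HB.instance Definition _ := Choice.on presented.
HB.instance Definition _ := EqQuotient.on presented.

Lemma presented_eqP u v :
  word_eq R u v <-> \pi_presented u = \pi_presented v.
Proof.
by split=> [uv|/eqmodP/asboolP//]; apply/eqmodP/asboolP.
Qed.

Lemma word_eq_repr w : word_eq R (repr (\pi_presented w)) w.
Proof. by apply/presented_eqP; rewrite reprK. Qed.

Lemma word_inv_cat u v : word_inv (u ++ v) = word_inv v ++ word_inv u.
Proof. by rewrite /word_inv map_cat rev_cat. Qed.

Lemma word_invK : involutive (@word_inv X).
Proof.
move=> w; rewrite /word_inv map_rev revK -map_comp map_id_in //.
by case=> x b _ /=; rewrite negbK.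
Qed.

Lemma word_eq_invl w : word_eq R (word_inv w ++ w) [::].
Proof.
elim: w => [|[x b] w IHw]; first exact: weq_refl.
rewrite -cat1s word_inv_cat -catA; apply: weq_trans IHw.
apply: weq_cat; first exact: weq_refl.
rewrite catA -[w in word_eq _ _ w]cat0s; apply: weq_cat (weq_refl _ _).
by have := weq_cancel R x (~~ b); rewrite negbK.
Qed.

Lemma word_eq_invr w : word_eq R (w ++ word_inv w) [::].
Proof. by have := word_eq_invl (word_inv w); rewrite word_invK. Qed.

Lemma word_eq_inv u v : word_eq R u v -> word_eq R (word_inv u) (word_inv v).
Proof.
move=> uv; apply: (@weq_trans _ _ _ (word_inv u ++ (v ++ word_inv v))).
  rewrite -[w in word_eq _ w]cats0; apply: weq_cat; first exact: weq_refl.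
  exact/weq_sym/word_eq_invr.
rewrite catA -[w in word_eq _ _ w]cat0s; apply: weq_cat (weq_refl _ _).
apply: weq_trans (word_eq_invl u).
by apply: weq_cat; [exact: weq_refl | exact: weq_sym].
Qed.

Definition presented_one : presented := \pi_presented [::].
Definition presented_mul (a b : presented) : presented :=
  \pi_presented (repr a ++ repr b).
Definition presented_inv (a : presented) : presented :=
  \pi_presented (word_inv (repr a)).

Lemma presented_mulE u v :
  presented_mul (\pi u) (\pi v) = \pi_presented (u ++ v).
Proof. by apply/presented_eqP/weq_cat; apply: word_eq_repr. Qed.

Lemma presented_invE u : presented_inv (\pi u) = \pi_presented (word_inv u).
Proof. exact/presented_eqP/word_eq_inv/word_eq_repr. Qed.

Lemma presented_mulA : associative presented_mul.
Proof.
move=> a b c; rewrite -[a]reprK -[b]reprK -[c]reprK.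
by rewrite !presented_mulE catA.
Qed.

Lemma presented_mul1 : left_id presented_one presented_mul.
Proof. by move=> a; rewrite -[a]reprK presented_mulE. Qed.

Lemma presented_mulr1 : right_id presented_one presented_mul.
Proof. by move=> a; rewrite -[a]reprK presented_mulE cats0. Qed.

Lemma presented_mulV : left_inverse presented_one presented_inv presented_mul.
Proof.
move=> a; rewrite -[a]reprK presented_invE presented_mulE.
exact/presented_eqP/word_eq_invl.
Qed.

Lemma presented_mulrV : right_inverse presented_one presented_inv presented_mul.
Proof.
move=> a; rewrite -[a]reprK presented_invE presented_mulE.
exact/presented_eqP/word_eq_invr.
Qed.

HB.instance Definition _ := isGroup.Build presented
  presented_mulA presented_mul1 presented_mulr1 presented_mulV presented_mulrV.

End PresentedGroup.

Section Subgroup.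
Variables (G : groupType) (S : groupClosed G).

Definition subgroup := {x : G | x \in S}.
HB.instance Definition _ := SubChoice.on subgroup.

Lemma subgroup_group_closed : group_closed (S : {pred G}).
Proof. by split; [exact: gpred1 | exact: gpredF]. Qed.

HB.instance Definition _ := SubChoice_isSubGroup.Build G (fun x => x \in S)
  subgroup subgroup_group_closed.

End Subgroup.

Definition isomorphic (G H : groupType) : Prop :=
  exists f : {multiplicative G -> H}, bijective f.

Definition finitely_generated (G : groupType) : Prop :=
  exists s : seq G, forall S : groupClosed G,
    {subset s <= (S : {pred G})} -> forall x : G, x \in S.

Definition finitely_presented (G : groupType) : Prop :=
  exists (n : nat) (rs : seq (word 'I_n)), isomorphic G (presented [set` rs]).

Definition coherent (G : groupType) : Prop :=
  forall S : groupClosed G,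
    finitely_generated (subgroup S) -> finitely_presented (subgroup S).

Section GraphProduct.
Variables (V : finType) (E : rel V) (phi : V -> groupType).

Definition letter (v : V) (g : phi v) (inverse : bool) :
    {v : V & phi v} * bool :=
  (Tagged (fun v => phi v : Type) g, inverse).

(* With these relators alone, the presented group is the free product of the  *)
(* phi v.                                                                     *)
Definition free_product_relators : set (word {v : V & phi v}) :=
  [set r | exists (v : V) (g h : phi v),
     r = [:: letter g false; letter h false; letter (g * h) true]].

Definition edge_relators : set (word {v : V & phi v}) :=
  [set r | exists (v w : V) (g : phi v) (h : phi w), E v w /\
     r = [:: letter g true; letter h true; letter g false; letter h false]].

Definition graph_product : groupType :=
  presented (free_product_relators `|` edge_relators).

End GraphProduct.

(* The vertices of c, in this cyclic order, induce a cycle of length size c:  *)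
(* the edges between them are exactly those joining consecutive vertices.     *)
Definition induced_cycle (V : finType) (E : rel V) (c : seq V) : Prop :=
  [/\ 2 < size c, uniq c &
      {in c &, forall x y, E x y = (next c x == y) || (next c y == x)}].

(* Main.v *)
From HB Require Import structures.
From mathcomp Require Import boolp classical_sets.
From mathcomp Require Import all_boot.
Require Import Defs.

Set Implicit Arguments.
Unset Strict Implicit.
Unset Printing Implicit Defensive.

(** A chordal graph has a simplicial vertex v, one whose neighbours are pairwise
    adjacent ([simplicial_vertex]).  Let H be the graph product over the other
    vertices and C the subgroup generated by the vertex groups of v and of its
    neighbours.  Then C is a finitely generated abelian group and the graph
    product is the amalgam of H and C over the group of the link of v
    ([simplicial_elimination]).  By induction on the number of vertices it is
    enough to see that an amalgam of a coherent group H with a finitely generated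
    abelian group C is coherent ([amalgam_tuple_coherent]).

    This is the theorem of Karrass and Solitar, obtained here from the action of
    the amalgam on its Bass-Serre tree.  Let K be a finitely generated group
    acting on a tree, such that the subgroups of edge stabilizers are finitely
    generated and the finitely generated subgroups of vertex stabilizers are
    finitely presented.  Then K is finitely presented ([tree_tuple_coherent]), for
    the following reason.  Join a base vertex to its
    translates by the generators of K; this gives finitely many edges.  Write
    K = F / N with F free of finite rank.  For a large enough finite subset R of
    N, finitely generated subgroups of the vertex stabilizers, which contain the
    relevant edge stabilizers, lift to F / <<R>>
    ([transporter_lift], [edge_transporters]).  The lifted subgroups are the
    vertex groups of a connected graph with an action of F / <<R>>, and this graph
    maps to the tree.  The map is locally injective because the edge stabilizers
    have been lifted too, and a locally injective map from a connected graph to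
    a tree is injective ([locally_injective_walk]).  Hence an element of N moves
    no vertex of the graph, so that it lies in a lifted vertex group; as these
    embed in K, it is trivial in F / <<R>>.  So R presents K.

    That the cosets of H and C form a tree comes from a ping-pong argument: the
    graph product acts on the free product of copies of the group of v indexed by
    the cosets in H of the link group.  That free product is realized by its
    reduced words, so that the action also proves the normal form theorem which
    the argument needs. *)

(** * Simplicial vertices of chordal graphs *)

Lemma sorted_cat_cons (T : Type) (e : rel T) s1 a s2 :
  sorted e (s1 ++ a :: s2) = sorted e (rcons s1 a) && path e a s2.
Proof.
case: s1 => [|z s1] //=.
by rewrite cat_path rcons_path /= andbA.
Qed.

Lemma split_nth2 (T : Type) (x0 : T) s i j : i < j < size s ->
  exists s1 s2 s3, s = s1 ++ nth x0 s i :: s2 ++ nth x0 s j :: s3 /\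
    size s2 = (j - i.+1)%N.
Proof.
case/andP=> ij js; have si := ltn_trans ij js.
exists (take i s), (take (j - i.+1) (drop i.+1 s)), (drop j.+1 s).
rewrite -drop_nth // -{2}(subnK ij) -drop_drop cat_take_drop -drop_nth //.
rewrite cat_take_drop size_take size_drop; split=> //.
by case: ltnP => // le; apply/eqP; rewrite eqn_leq le leq_sub2r // ltnW.
Qed.

Section Chordal.
Variables (V : finType) (E : rel V).
Hypothesis E_sym : symmetric E.
Hypothesis E_irr : irreflexive E.
Hypothesis chordal : forall c : seq V, induced_cycle E c -> ~ (3 < size c).

(** A shortest path from [x] to [y] through [C] has no chord, so that it closes up
    with [v] to an induced cycle; the cycle has length at least 4 because [x] and
    [y] are not adjacent.  Starting from any path, one is shortened until it
    becomes shortest. *)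
Lemma no_separating_path (v x y : V) (C : {set V}) (s : seq V) :
    E v x -> E v y -> x != y -> ~~ E x y ->
    {in C, forall z, (z != v) && ~~ E v z} ->
  ~ [/\ sorted E s, head v s = x, last v s = y &
        all (fun z => [|| z == x, z == y | z \in C]) s].
Proof.
move=> vx vy xNy nxy Cv; have [n] := ubnP (size s); elim: n s => // n IHn s.
rewrite ltnS => sn [sE sx sy sC].
have vNx : v != x by apply: contraTneq vx => ->; rewrite E_irr.
have vNy : v != y by apply: contraTneq vy => ->; rewrite E_irr.
have vs : v \notin s.
  apply/negP => /(allP sC); rewrite (negPf vNx) (negPf vNy) /=.
  by move=> /Cv; rewrite eqxx.
(* The induction hypothesis refutes every shorter path, hence a repetition or
   a chord in s. *)
have short s1 a s2 b s3 : s = s1 ++ a :: s2 ++ b :: s3 ->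
    (a == b) || (E a b && (0 < size s2)) -> False.
  move=> sd ab.
  pose t := if a == b then s3 else b :: s3.
  have [at_ st lt tC] : [/\ path E a t, size t < size (s2 ++ b :: s3),
      last a t = last a (s2 ++ b :: s3) & {subset t <= s2 ++ b :: s3}].
    move: sE; rewrite sd sorted_cat_cons cat_path => /= /andP[_ /andP[_ /andP[_ bs3]]].
    rewrite /t; case: eqVneq ab bs3 => [<- _ bs3|_ /= /andP[ab s20] bs3].
      split=> //; rewrite ?size_cat ?last_cat //=; first by rewrite addnS ltnS leq_addl.
      by move=> z zs3; rewrite mem_cat inE zs3 !orbT.
    split; rewrite /= ?ab ?size_cat ?last_cat //=; first by rewrite -add1n leq_add2r.
    by move=> z zs3; rewrite mem_cat zs3 orbT.
  apply: (IHn (s1 ++ a :: t)).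
    by apply: leq_trans sn; rewrite sd !size_cat ltn_add2l.
  split.
  - by move: sE; rewrite sd !sorted_cat_cons at_ => /andP[->].
  - by rewrite -sx sd; case: (s1).
  - by rewrite -sy sd !last_cat.
  - apply/allP => z zt; apply: (allP sC); rewrite sd; move: zt.
    rewrite !mem_cat !inE => /or3P[->|->|/tC]; rewrite ?orbT //.
    by rewrite mem_cat inE => ->; rewrite !orbT.
have us : uniq s.
  apply/negPn/negP => /(uniqPn v)[i [j [ij js sij]]].
  have [|s1 [s2 [s3 [sd _]]]] := @split_nth2 _ v s i j; first by rewrite ij.
  by apply: (short _ _ _ _ _ sd); rewrite sij eqxx.
have adj i j : i < j < size s -> E (nth v s i) (nth v s j) = (j == i.+1).
  move=> ijs; have /andP[ij js] := ijs; apply/idP/eqP => [sij|jE]; last first.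
    by rewrite jE; move/(sortedP v): sE; apply; rewrite -jE.
  have [s1 [s2 [s3 [sd s2E]]]] := split_nth2 v ijs.
  apply/eqP; rewrite eqn_leq ij andbT -subn_eq0 -s2E -leqn0 leqNgt.
  by apply/negP => s20; apply: (short _ _ _ _ _ sd); rewrite sij s20 orbT.
have s3 : 2 < size s.
  case: s sE sx sy {sn sC vs short us adj} => [|a [|b [|d s]]] //=.
  - by move=> _ vx0; move: vNx; rewrite vx0 eqxx.
  - by move=> _ ax ay; move: xNy; rewrite -ax -ay eqxx.
  - by rewrite andbT => ab ax bx; move: nxy; rewrite -ax -bx ab.
have x0 : nth v s 0 = x by rewrite nth0.
have y0 : nth v s (size s).-1 = y by rewrite nth_last -sy; case: (s) s3.
have s0 : 0 < size s by apply: leq_trans s3.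
have nthx i : i < size s -> (nth v s i == x) = (i == 0).
  by move=> si; rewrite -x0 nth_uniq.
have nthy i : i < size s -> (nth v s i == y) = (i.+1 == size s).
  by move=> si; rewrite -y0 nth_uniq // ?prednK // -(eqn_add2l 1) !add1n prednK.
have Ev i : i < size s -> E v (nth v s i) = (i == 0) || (i.+1 == size s).
  move=> si; have /or3P[] := allP sC _ (mem_nth v si).
  - by move=> six; rewrite (eqP six) vx -nthx // six.
  - by move=> siy; rewrite (eqP siy) vy -(nthy i) // siy orbT.
  move=> /Cv/andP[_ nvs]; rewrite (negPf nvs) -nthx // -nthy //.
  by apply/esym/negP => /orP[] /eqP sE'; move: nvs; rewrite sE' ?vx ?vy.
have nextv : next (v :: s) v = x.
  by rewrite /= -x0; case: (s) s0 => //= z t _; rewrite eqxx.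
have nexts i : i < size s -> next (v :: s) (nth v s i) = nth v s i.+1.
  move=> si; rewrite next_nth inE mem_nth ?orbT //= index_uniq //.
  by case: eqVneq => // vi; move: vs; rewrite vi mem_nth.
have nextsv i : i < size s -> (nth v s i.+1 == v) = (i.+1 == size s).
  move=> si; have [si1|si1] := ltnP i.+1 (size s); last first.
    by rewrite nth_default // eqxx eqn_leq si si1.
  rewrite (ltn_eqF si1).
  by apply: contraNF vs => /eqP<-; apply: mem_nth.
have vsi i : i < size s -> (v == nth v s i) = false.
  by move=> si; apply: contraNF vs => /eqP->; apply: mem_nth.
(* With default value [v], [nth v s] also reads the successor of the last vertex
   of s in the cycle. *)
apply: (chordal (c := v :: s)); last by rewrite /= ltnS.
split; [exact: leqW|by rewrite /= vs|].
have nxt i j : i < size s -> j < size s -> (nth v s i.+1 == nth v s j) = (j == i.+1).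
  move=> si sj; have [si1|] := ltnP i.+1 (size s).
    by rewrite nth_uniq // eq_sym.
  move=> si1; rewrite nth_default // vsi //; apply/esym/negbTE.
  by rewrite neq_ltn (leq_trans sj si1).
move=> a b; rewrite !inE => /predU1P[->|/(nthP v)[i si <-]] /predU1P[->|/(nthP v)[j sj <-]].
- by rewrite E_irr nextv eq_sym (negPf vNx).
- by rewrite Ev // nextv nexts // [x == _]eq_sym nthx // nextsv.
- by rewrite E_sym Ev // nextv nexts // [x == _]eq_sym nthx // nextsv // orbC.
rewrite !nexts // !nxt //.
have [ij|ji|ij] := ltngtP i j.
- rewrite adj ?ij // [i == _]ltn_eqF ?orbF //; exact: leqW.
- rewrite E_sym adj ?ji // [j == _]ltn_eqF //; exact: leqW.
- by rewrite ij E_irr eqn_leq ltnn andbF.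
Qed.

(** Choose [v] and a component [C] of what remains after removal of [v] and its
    neighbours, with [C] as large as possible, and let [S] be the set of the
    neighbours of [C].  By [no_separating_path], [S] is a clique.  Every vertex [w]
    outside [C] and [S] is adjacent to all of [S]: otherwise [C] together with a
    vertex of [S] would be connected off the closed neighbourhood of [w], against
    the choice of [C].  So a simplicial vertex of the complement of [C] and [S],
    which contains [v], stays simplicial in [A]. *)
Lemma simplicial_vertex_in (A : {set V}) x0 : x0 \in A ->
  exists2 w, w \in A & {in A &, forall a b, E w a -> E w b -> a != b -> E a b}.
Proof.
have [n] := ubnP #|A|; elim: n A x0 => // n IHn A x0; rewrite ltnS => An x0A.
pose D v := [set z in A | (z != v) && ~~ E v z].
pose e v := [rel a b | [&& E a b, a \in D v & b \in D v]].
pose comp v c := [set z | connect (e v) c z].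
have eC v : connect_sym (e v).
  by apply: sym_connect_sym => a b /=; rewrite E_sym; case: (E b a); rewrite //= andbC.
have compD v c : c \in D v -> comp v c \subset D v.
  move=> cD; apply/subsetP => z; rewrite inE => /connectP[p].
  elim/last_ind: p => [_ ->//|p z' _]; rewrite rcons_path last_rcons.
  by case/andP=> _ /and3P[_ _ z'D] ->.
have [/existsP[[v0 c0] /= vc0]|] :=
    boolP [exists vc : V * V, (vc.1 \in A) && (vc.2 \in D vc.1)]; last first.
  (* All of A is a clique. *)
  move=> /existsPn noD; exists x0 => // a b aA bA _ _ ab.
  by have := noD (a, b); rewrite /= aA /D inE bA eq_sym ab /= negbK.
have [v [c [vA cD vcmax]]] : exists v c, [/\ v \in A, c \in D v &
    forall w d, w \in A -> d \in D w -> #|comp w d| <= #|comp v c|].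
  have [[v c] /= /andP[vA cD] vcmax] := @arg_maxnP _ (v0, c0)
    (fun vc => (vc.1 \in A) && (vc.2 \in D vc.1)) (fun vc => #|comp vc.1 vc.2|) vc0.
  by exists v, c; split=> // w d wA dD; apply: (vcmax (w, d)); rewrite /= wA.
set C := comp v c in vcmax.
have CD : C \subset D v by exact: compD.
have cC : c \in C by rewrite inE connect0.
have CA z : z \in C -> z \in A by move/(subsetP CD); rewrite inE => /andP[].
have Cv : {in C, forall z, (z != v) && ~~ E v z}.
  by move=> z /(subsetP CD); rewrite inE => /andP[].
pose S := [set x in A | (x \notin C) && [exists z in C, E z x]].
have SE x : x \in A -> x \notin C -> forall z, z \in C -> E z x -> x \in S.
  by move=> xA xC z zC zx; rewrite inE xA xC; apply/existsP; exists z; rewrite zC.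
have Sv x : x \in S -> E v x.
  rewrite inE => /and3P[xA xC /existsP[z /andP[zC zx]]]; apply: contraNT xC => nvx.
  have xv : x != v.
    by apply: contraTneq zx => ->; rewrite E_sym; have /andP[] := Cv z zC.
  rewrite inE; rewrite inE in zC; apply: (connect_trans zC); apply: connect1.
  by rewrite /= zx (subsetP CD) ?inE ?xA ?xv.
have Sclique : {in S &, forall x y, x != y -> E x y}.
  move=> x y xS yS xy; apply/negPn/negP => nxy.
  have := xS; rewrite inE => /and3P[_ _ /existsP[z1 /andP[z1C z1x]]].
  have := yS; rewrite inE => /and3P[_ _ /existsP[z2 /andP[z2C z2y]]].
  have : connect (e v) z1 z2.
    by move: z1C z2C; rewrite !inE [connect _ c z1]eC => cz1; apply: connect_trans.
  case/connectP=> p ep pz2.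
  apply: (@no_separating_path v x y C (x :: z1 :: rcons p y)) (Sv _ xS) (Sv _ yS) xy nxy Cv _.
  have pC : {subset z1 :: p <= C}.
    move=> z zp; have : connect (e v) z1 z by apply: path_connect zp.
    by move: z1C; rewrite !inE; apply: connect_trans.
  split=> //.
  - rewrite /= E_sym z1x rcons_path -pz2 z2y andbT /=.
    by apply: sub_path ep => a b /and3P[].
  - by rewrite /= last_rcons.
  - rewrite /= eqxx /= pC ?mem_head ?orbT //= all_rcons eqxx orbT /=.
    by apply/allP => z zp; rewrite pC ?inE ?zp ?orbT.
pose B := A :\: (C :|: S).
have BA w : w \in B -> w \in A by rewrite inE => /andP[].
have BC w : w \in B -> w \notin C.
  by rewrite inE => /andP[]; rewrite inE negb_or => /andP[].
have BnS w : w \in B -> w \notin S.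
  by rewrite inE => /andP[]; rewrite inE negb_or => /andP[].
have vB : v \in B.
  rewrite inE vA andbT inE negb_or; apply/andP; split.
    by apply/negP => /Cv; rewrite eqxx.
  by apply/negP => /Sv; rewrite E_irr.
have BS w x : w \in B -> x \in S -> E w x.
  move=> wB xS; apply/negPn/negP => nwx.
  have [xA xC] : x \in A /\ x \notin C by move: xS; rewrite inE => /and3P[].
  have CDw z : z \in C -> z \in D w.
    move=> zC; rewrite inE CA //=; apply/andP; split.
      by apply: contraTneq zC => ->; apply: BC.
    apply: contra (BnS _ wB) => wz; apply: (SE _ _ _ z) => //; first exact: BA.
      exact: BC.
    by rewrite E_sym.
  have xDw : x \in D w.
    rewrite inE xA nwx andbT /=; apply: contraTneq xS => ->; exact: BnS.
  have Cw z : z \in C -> z \in comp w c.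
    rewrite !inE => /connectP[p]; elim/last_ind: p z => [|p z' IHp] z.
      by move=> _ ->; apply: connect0.
    rewrite rcons_path last_rcons => /andP[ep pz'] ->.
    have pC : last c p \in C by rewrite inE; apply/connectP; exists p.
    have z'C : z' \in C.
      by rewrite inE; apply/connectP; exists (rcons p z'); rewrite ?last_rcons ?rcons_path ?ep.
    apply: (connect_trans (IHp _ ep erefl)); apply: connect1.
    by case/and3P: pz' => pz' _ _; rewrite /= pz' !CDw.
  have xw : x \in comp w c.
    have := xS; rewrite inE => /and3P[_ _ /existsP[z /andP[zC zx]]].
    rewrite inE; have := Cw z zC; rewrite inE => /connect_trans; apply.
    by apply: connect1; rewrite /= zx CDw.
  have := vcmax w c (BA _ wB) (CDw _ cC); rewrite leqNgt => /negP; apply.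
  apply: proper_card; apply/properP; split; first by apply/subsetP.
  by exists x.
have [|w wB wP] := IHn B v _ vB.
  apply: leq_trans An; apply: proper_card; apply/properP; split.
    exact: subsetDl.
  by exists c; rewrite ?CA // inE inE cC.
have AC a : a \in A -> E w a -> (a \in B) || (a \in S).
  move=> aA wa; rewrite [a \in B]inE inE aA andbT negb_or.
  case: (boolP (a \in S)) => aS; rewrite ?orbT // orbF andbT.
  apply: contraTN wa => aC; apply: contra (BnS _ wB) => wa.
  by apply: (SE _ _ _ a aC); rewrite ?BA ?BC // E_sym.
exists w; first exact: BA.
move=> a b aA bA wa wb ab.
case/orP: (AC a aA wa) (AC b bA wb) => [aB|aS] /orP[bB|bS].
- exact: wP.
- exact: BS.
- by rewrite E_sym; apply: BS.
- exact: Sclique.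
Qed.

Theorem simplicial_vertex (x0 : V) :
  exists w, forall a b, E w a -> E w b -> a != b -> E a b.
Proof.
have [w _ wP] := simplicial_vertex_in (in_setT x0).
by exists w => a b; apply: wP; rewrite in_setT.
Qed.

End Chordal.

Local Open Scope classical_set_scope.
Local Open Scope quotient_scope.
Local Open Scope group_scope.

(** * Words and their evaluation *)

Lemma morph_one (G H : groupType) (f : G -> H) : {morph f : x y / x * y} -> f 1 = 1.
Proof. by move=> fM; apply: (@mulgI _ (f 1)); rewrite -fM !mulg1. Qed.

Lemma morph_inv (G H : groupType) (f : G -> H) :
  {morph f : x y / x * y} -> {morph f : x / x^-1}.
Proof. by move=> fM x; apply/esym/mulg1_eq; rewrite -fM mulgV morph_one. Qed.

Definition letter_val (X : Type) (G : groupType) (a : X -> G) (l : X * bool) :=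
  if l.2 then (a l.1)^-1 else a l.1.

Fixpoint ev (X : Type) (G : groupType) (a : X -> G) (w : word X) : G :=
  if w is l :: w' then letter_val a l * ev a w' else 1.

Section Evaluation.
Variables (X : choiceType) (G : groupType) (a : X -> G).
Implicit Types (u v w : word X) (R : set (word X)).

Lemma ev_cat u v : ev a (u ++ v) = ev a u * ev a v.
Proof. by elim: u => [|l u IH] /=; rewrite ?mul1g // IH mulgA. Qed.

Lemma ev_inv w : ev a (word_inv w) = (ev a w)^-1.
Proof.
elim: w => [|[x b] w IH]; first by rewrite /= invg1.
rewrite -cat1s word_inv_cat !ev_cat IH invgM; congr (_ * _).
by rewrite /= !mulg1 /letter_val /=; case: b; rewrite /= ?invgK.
Qed.

Lemma ev_word_eq R u v :
  (forall r, R r -> ev a r = 1) -> word_eq R u v -> ev a u = ev a v.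
Proof.
move=> R1; elim=> {u v} [//|u v _ -> //|u v w _ -> _ -> //||x b|r /R1 //].
  by move=> u u' v v' _ Eu _ Ev; rewrite !ev_cat Eu Ev.
by rewrite /= mulg1 /letter_val; case: b => /=; rewrite (mulVg, mulgV).
Qed.

Lemma ev_morph (H : groupType) (f : G -> H) :
    {morph f : x y / x * y} ->
  forall w, ev (f \o a) w = f (ev a w).
Proof.
move=> fM; elim=> [|[x b] w IH] /=; first by rewrite morph_one.
rewrite fM IH; congr (_ * _).
by rewrite /letter_val /=; case: b; rewrite // morph_inv.
Qed.

End Evaluation.

Section WordCongruence.
Variables (X : choiceType) (R : set (word X)).
Implicit Types u v w : word X.

Lemma weq_catl w u v : word_eq R u v -> word_eq R (w ++ u) (w ++ v).
Proof. exact: weq_cat (weq_refl _ _). Qed.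

Lemma weq_catr w u v : word_eq R u v -> word_eq R (u ++ w) (v ++ w).
Proof. by move=> /weq_cat; apply; apply: weq_refl. Qed.

Lemma word_eq_invrK u v : word_eq R (u ++ (word_inv u ++ v)) v.
Proof. by rewrite catA; apply: (@weq_catr v _ [::]); apply: word_eq_invr. Qed.

Lemma word_eq_quot u v : word_eq R (word_inv u ++ v) [::] <-> word_eq R u v.
Proof.
split=> [/(weq_catl u)|/(weq_catl (word_inv u))] uv.
  by have := weq_trans (weq_sym (word_eq_invrK u v)) uv; rewrite cats0 => /weq_sym.
exact: weq_trans (weq_sym uv) (word_eq_invl _ u).
Qed.

End WordCongruence.

Fixpoint wsubst (X Y : Type) (f : X -> word Y) (w : word X) : word Y :=
  if w is l :: w' then
    (if l.2 then word_inv (f l.1) else f l.1) ++ wsubst f w'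
  else [::].

Section Substitution.
Variables (X Y : choiceType) (f : X -> word Y).
Implicit Types u v w : word X.

Lemma wsubst_cat u v : wsubst f (u ++ v) = wsubst f u ++ wsubst f v.
Proof. by elim: u => //= l u ->; rewrite catA. Qed.

Lemma wsubst_inv w : wsubst f (word_inv w) = word_inv (wsubst f w).
Proof.
elim: w => [|[x b] w IH] //; rewrite -cat1s word_inv_cat !wsubst_cat IH.
rewrite word_inv_cat; congr (_ ++ _); rewrite /= !cats0.
by case: b; rewrite /= ?word_invK.
Qed.

Lemma ev_wsubst (G : groupType) (a : Y -> G) w :
  ev a (wsubst f w) = ev (fun x => ev a (f x)) w.
Proof.
elim: w => //= -[x b] w IH; rewrite ev_cat IH; congr (_ * _).
by rewrite /letter_val; case: b => //=; rewrite ev_inv.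
Qed.

Lemma word_eq_wsubst R R' u v :
    (forall r, R r -> word_eq R' (wsubst f r) [::]) ->
  word_eq R u v -> word_eq R' (wsubst f u) (wsubst f v).
Proof.
move=> RR'; elim=> {u v}.
- by move=> w; apply: weq_refl.
- by move=> u v _; apply: weq_sym.
- by move=> u v w _ uv _; apply: weq_trans.
- by move=> u u' v v' _ Eu _ Ev; rewrite !wsubst_cat; apply: weq_cat.
- move=> x b; rewrite /= cats0.
  by case: b; rewrite /=; [apply: word_eq_invl|apply: word_eq_invr].
- by move=> r /RR'.
Qed.

End Substitution.

(** * Generated subgroups and finite relatedness *)

Definition is_subgroup (G : groupType) (S : set G) :=
  [/\ S 1, forall x y, S x -> S y -> S (x * y) & forall x, S x -> S x^-1].

Definition gen (G : groupType) (A : set G) : set G :=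
  [set x | forall S : set G, is_subgroup S -> A `<=` S -> S x].

Section Generation.
Variable G : groupType.
Implicit Types A B S : set G.

Lemma gen_subgroup A : is_subgroup (gen A).
Proof.
split=> [S [] //|x y Ax Ay S SS AS|x Ax S SS AS]; have [_ SM SV] := SS.
  by apply: SM; [apply: Ax|apply: Ay].
by apply: SV; apply: Ax.
Qed.

Lemma sub_gen A : A `<=` gen A.
Proof. by move=> x Ax S _; apply. Qed.

Lemma gen_sub A S : is_subgroup S -> A `<=` S -> gen A `<=` S.
Proof. by move=> SS AS x; apply. Qed.

Lemma genS A B : A `<=` B -> gen A `<=` gen B.
Proof.
by move=> AB; apply: gen_sub (gen_subgroup _) _ => x /AB; apply: sub_gen.
Qed.

Lemma ev_in (X : choiceType) (a : X -> G) S w :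
  is_subgroup S -> (forall x, S (a x)) -> S (ev a w).
Proof.
move=> [S1 SM SV] Sa; elim: w => //= -[x b] w IH; apply: SM => //.
by rewrite /letter_val; case: b => //=; apply: SV.
Qed.

Lemma gen_range (X : choiceType) (a : X -> G) x :
  gen (range a) x <-> exists w, ev a w = x.
Proof.
split=> [|[w <-]]; last first.
  by apply: ev_in (gen_subgroup _) _ => i; apply: sub_gen; exists i.
move/(_ [set x | exists w, ev a w = x]); apply; last first.
  by move=> _ [i _ <-]; exists [:: (i, false)]; rewrite /= mulg1.
split=> [|_ _ [u <-] [v <-]|_ [u <-]]; first by exists [::].
  by exists (u ++ v); rewrite ev_cat.
by exists (word_inv u); rewrite ev_inv.
Qed.

Lemma gen_commute A : (forall x y, A x -> A y -> commute x y) ->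
  forall x y, gen A x -> gen A y -> commute x y.
Proof.
have cent B : is_subgroup [set x | forall y, B y -> commute x y].
  split=> [y _|x y xB yB z Bz|x xB y By].
  - exact/commute_sym/commute1.
  - by apply/commute_sym/commuteM; apply/commute_sym; [apply: xB|apply: yB].
  - exact/commute_sym/commuteV/commute_sym/xB.
move=> cAA; have cgA : gen A `<=` [set x | forall y, A y -> commute x y].
  by apply: gen_sub => // x Ax y; apply: cAA.
move=> x y Ax; move: y; suff: gen A `<=` [set y | forall z, gen A z -> commute y z].
  by move=> s y Ay; apply: s.
by apply: gen_sub => // y Ay z /cgA/(_ y Ay)/commute_sym.
Qed.

End Generation.

Lemma gen_morph (G H : groupType) (f : G -> H) (A : set G) (B : set H) :
    {morph f : x y / x * y} -> (forall x, A x -> gen B (f x)) ->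
  forall x, gen A x -> gen B (f x).
Proof.
move=> fM AB; apply: (@gen_sub _ A [set x | gen B (f x)]) => //.
have [B1 BM BV] := gen_subgroup B.
split=> /= [|x y Bx By|x Bx]; first by rewrite morph_one.
  by rewrite fM; apply: BM.
by rewrite morph_inv //; apply: BV.
Qed.

Definition fin_related (X : choiceType) (G : groupType) (a : X -> G) :=
  exists rs : seq (word X),
    forall w, ev a w = 1 <-> word_eq [set` rs] w [::].

(** A finitely generated subgroup is finitely presented as soon as one of its
    finite generating tuples is finitely related, so this property implies
    coherence.  Speaking of all tuples of one ambient group makes it pass to
    subgroups, and no change of generators is ever needed. *)
Definition tuple_coherent (G : groupType) :=
  forall n (a : 'I_n -> G), fin_related a.

Lemma fin_related_ev_eq (X : choiceType) (G : groupType) (a : X -> G)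
    (rs : seq (word X)) :
    (forall w, ev a w = 1 <-> word_eq [set` rs] w [::]) ->
  forall u v, ev a u = ev a v <-> word_eq [set` rs] u v.
Proof.
move=> rsP u v; rewrite -word_eq_quot -rsP ev_cat ev_inv.
by split=> [->|/mulg1_eq]; [rewrite mulVg|rewrite invgK].
Qed.

(** The relations of a tuple are those of its image under a homomorphism that is
    injective on the subgroup which the tuple generates. *)
Lemma fin_related_inj (X : choiceType) (G H : groupType) (f : G -> H)
    (a : X -> G) :
    {morph f : x y / x * y} ->
    (forall x, gen (range a) x -> f x = 1 -> x = 1) ->
  fin_related (f \o a) -> fin_related a.
Proof.
move=> fM finj [rs rsP]; exists rs => w; rewrite -rsP ev_morph //.
by split=> [->|]; [apply: morph_one|apply: finj; apply/gen_range; exists w].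
Qed.

Lemma finitely_generated_gen (G : groupType) :
  finitely_generated G -> exists s : seq G, gen [set` s] = [set: G].
Proof.
move=> [s sgen]; exists s; apply/seteqP; split=> // x _ S [S1 SM SV] sS.
pose P : {pred G} := fun y => `[< S y >].
have Pcl : group_closed P.
  split=> [|y z /asboolP Sy /asboolP Sz]; apply/asboolP => //.
  by apply: SM => //; apply: SV.
pose PM := isMulClosed.Build _ P (group_closedM Pcl).
pose P1 := isMul1Closed.Build _ P Pcl.1.
pose PV := isInvClosed.Build _ P (group_closedV Pcl).
pose Pg : groupClosed G := HB.pack P PM P1 PV.
have /asboolP// : x \in (Pg : {pred G}).
by apply: sgen => y ys; apply/asboolP/sS.
Qed.

Lemma range_nth (T : choiceType) (x0 : T) (s : seq T) :
  range (fun i : 'I_(size s) => nth x0 s i) = [set` s].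
Proof.
apply/seteqP; split=> [_ [i _ <-]|x /(nthP x0) [i si <-]].
  by rewrite /= mem_nth.
by exists (Ordinal si).
Qed.

Lemma tuple_coherent_coherent (G : groupType) :
  tuple_coherent G -> coherent G.
Proof.
move=> cohG S /finitely_generated_gen[s sgen].
pose a (i : 'I_(size s)) : subgroup S := nth 1 s i.
have aS x : exists w, ev a w = x.
  by apply/gen_range; rewrite range_nth sgen.
have : fin_related a.
  apply: (@fin_related_inj _ _ _ (val : subgroup S -> G)); [by []| |exact: cohG].
  by move=> x _ x1; apply: val_inj.
case=> rs rsP; exists (size s), rs.
have evE := fin_related_ev_eq rsP.
pose f (x : subgroup S) : presented [set` rs] :=
  \pi_(presented [set` rs]) (xget [::] [set w | ev a w = x]).
have fE w : f (ev a w) = \pi_(presented [set` rs]) w.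
  apply/presented_eqP/evE; case: xgetP => [y _ -> //|/(_ w) []//].
have fM : {morph f : x y / x * y}.
  move=> x y; have [[u <-] [v <-]] := (aS x, aS y).
  by rewrite -ev_cat !fE; apply/esym; apply: presented_mulE.
pose fm := isMultiplicative.Build _ _ f fM.
pose F : {multiplicative subgroup S -> presented [set` rs]} := HB.pack f fm.
exists F; exists (fun p => ev a (repr p)) => [x|p].
  have [w <-] := aS x; rewrite /F /= fE; apply/evE.
  by apply: word_eq_repr.
by rewrite /F /= fE reprK.
Qed.

Section Presented.
Variables (X : choiceType) (R : set (word X)).

Definition pgen (x : X) : presented R := \pi_(presented R) [:: (x, false)].

Lemma ev_pgen w : ev pgen w = \pi_(presented R) w.
Proof.
elim: w => [|[x b] w IH] //=; rewrite IH -cat1s.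
rewrite -[RHS]presented_mulE; congr (_ * _).
rewrite /letter_val; case: b => //=; exact: presented_invE.
Qed.

(** Turns identities between words modulo relators into identities in a group. *)
Lemma word_eq_pgen u v : word_eq R u v <-> ev pgen u = ev pgen v.
Proof. by rewrite !ev_pgen; apply: presented_eqP. Qed.

Lemma word_eq_pgen1 u : word_eq R u [::] <-> ev pgen u = 1.
Proof. exact: word_eq_pgen. Qed.

End Presented.

(** * Finitely generated abelian groups *)

(** The form [letter ^+ k * w'] of a word is found once for all groups, since it
    is used at the same time in a given group and in the group presented by
    candidate relators. *)
Lemma commuting_word_split n (w : word 'I_n.+1) :
  exists c k w', forall (M : groupType) (m : 'I_n.+1 -> M),
    (forall i, commute (m ord0) (m (lift ord0 i))) ->
    ev m w = letter_val m (ord0, c) ^+ k * ev (m \o lift ord0) w'.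
Proof.
elim: w => [|[i b] w [c [k [w' IH]]]].
  by exists false, 0%N, [::] => M m _; rewrite mulg1.
case: (unliftP ord0 i) => [j|] ->; last first.
  have [<-|cb] := eqVneq c b.
    exists c, k.+1, w' => M m cm.
    by rewrite /= IH // expgS mulgA.
  case: k IH => [|k] IH.
    exists b, 1%N, w' => M m cm.
    by rewrite /= IH // expg0 mul1g.
  exists c, k, w' => M m cm; rewrite /= IH // expgS !mulgA; congr (_ * _).
  rewrite -[RHS]mul1g; congr (_ * _).
  by rewrite /letter_val; case: b c cb {IH} => -[] //= _; rewrite (mulVg, mulgV).
exists c, k, ((j, b) :: w') => M m cm; rewrite /= IH // !mulgA; congr (_ * _).
have cjb : commute (m ord0) (letter_val m (lift ord0 j, b)).
  by rewrite /letter_val; case: b => /=; [apply: commuteV|].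
apply: commuteX; apply/commute_sym.
by rewrite /letter_val; case: c {IH} => //=; apply/commute_sym/commuteV/commute_sym.
Qed.

(** Subgroups of the integers are cyclic, in terms of nonnegative elements. *)
Lemma least_dividing (P : nat -> Prop) k :
    (forall i j, P i -> P (i + j) -> P j) -> 0 < k -> P k ->
  exists d, [/\ 0 < d, P d & forall j, P j -> d %| j].
Proof.
move=> Psub k0 Pk.
pose Q := [pred d | (0 < d) && `[< P d >]].
have exQ : exists d, Q d by exists k; rewrite /= k0; apply/asboolP.
have [d /andP[d0 /asboolP Pd] dmin] := ex_minnP exQ.
exists d; split=> // j Pj.
have : P (j %% d).
  rewrite {1}(divn_eq j d) in Pj; elim: (j %/ d) Pj => // q IHq.
  by rewrite mulSn -addnA => /(Psub _ _ Pd).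
rewrite /dvdn; case: (posnP (j %% d)) => // jd Pjd.
have := dmin (j %% d); rewrite /= jd /= => /(_ (introT (asboolP _) Pjd)).
by rewrite leqNgt ltn_mod d0.
Qed.

(** Induction on the number of generators.  To the relators of the last ones are
    added the commutators with the first one [z], and one relator expressing the
    least positive power of [z] which lies in the subgroup generated by the
    others, when there is such a power. *)
Lemma fin_related_abelian n (G : groupType) (b : 'I_n -> G) :
  (forall i j, commute (b i) (b j)) -> fin_related b.
Proof.
elim: n b => [|n IHn] b cb.
  by exists [::] => -[|[[]//]]; split=> // _; apply: weq_refl.
have [|rs' rsP'] := IHn (b \o lift ord0); first by move=> i j; apply: cb.
pose up (w : word 'I_n) : word 'I_n.+1 :=
  wsubst (fun i => [:: (lift ord0 i, false)]) w.
have ev_up (M : groupType) (m : 'I_n.+1 -> M) w : ev m (up w) = ev (m \o lift ord0) w.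
  rewrite ev_wsubst; congr (ev _ w).
  by apply/funext => i; rewrite /= mulg1.
pose z : 'I_n.+1 * bool := (ord0, false).
have ev_z (M : groupType) (m : 'I_n.+1 -> M) d : ev m (nseq d z) = m ord0 ^+ d.
  by elim: d => //= d ->; rewrite expgS.
pose P d := exists w, ev (b \o lift ord0) w = b ord0 ^+ d.
have Psub i j : P i -> P (i + j) -> P j.
  move=> [u Eu] [v Ev]; exists (word_inv u ++ v).
  by rewrite ev_cat ev_inv Eu Ev expgnDr mulKg.
pose com (i : 'I_n) : word 'I_n.+1 :=
  [:: z; (lift ord0 i, false); (ord0, true); (lift ord0 i, true)].
have [xr xrP] : exists xr : seq (word 'I_n.+1),
    (forall r, r \in xr -> ev b r = 1) /\
    forall k, 0 < k -> P k -> exists d w,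
    [/\ d %| k, ev (b \o lift ord0) w = b ord0 ^+ d &
      nseq d z ++ word_inv (up w) \in xr].
  have [[k [k0 Pk]]|noP] := pselect (exists k, 0 < k /\ P k); last first.
    by exists [::]; split=> // k k0 Pk; case: noP; exists k.
  have [d [d0 [w Ew] dmin]] := least_dividing Psub k0 Pk.
  exists [:: nseq d z ++ word_inv (up w)]; split=> [r|j j0 Pj].
    by rewrite inE => /eqP->; rewrite ev_cat ev_inv ev_up ev_z Ew mulgV.
  by exists d, w; rewrite inE eqxx; split=> //; apply: dmin.
pose rs := map up rs' ++ map com (enum 'I_n) ++ xr.
exists rs => w; split; last first.
  move/ev_word_eq; apply=> r; rewrite /= !mem_cat => /or3P[].
  - by case/mapP=> r' r'rs ->; rewrite ev_up; apply/rsP'/weq_rel.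
  - case/mapP=> i _ ->; rewrite /= /letter_val /= mulg1 mulgA cb.
    by rewrite -mulgA (mulgA (b ord0)) mulgV mul1g mulgV.
  - exact: xrP.1.
set Q := presented [set` rs].
pose q : 'I_n.+1 -> Q := pgen [set` rs].
have q_rs r : r \in rs -> ev q r = 1.
  by move=> rrs; apply/word_eq_pgen1/weq_rel.
have q_rs' u : ev (b \o lift ord0) u = 1 -> ev (q \o lift ord0) u = 1.
  move/rsP'; rewrite -ev_up => /(ev_word_eq (a := q \o lift ord0)).
  rewrite ev_up; apply=> r rrs'; rewrite -ev_up; apply: q_rs.
  by rewrite mem_cat map_f.
have cq i : commute (q ord0) (q (lift ord0 i)).
  have : ev q (com i) = 1.
    by apply: q_rs; rewrite !mem_cat map_f ?mem_enum ?orbT.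
  rewrite /= /letter_val /= mulg1 mulgA -invgM => /divg1_eq; exact.
have [c [k [w' wE]]] := commuting_word_split w.
rewrite wE // => bw1; apply/word_eq_pgen1; rewrite -/q wE //.
have [k0|k_gt0] := posnP k.
  by move: bw1; rewrite k0 !expg0 !mul1g; apply: q_rs'.
have [] := xrP.2 k => //.
  exists (if c then w' else word_inv w').
  have /mulg1_eq := bw1; rewrite /letter_val.
  by case: (c) => /= wE'; rewrite ?ev_inv -wE' ?expVgn invgK.
move=> d [u [dk Eu uxr]].
have qu : q ord0 ^+ d = ev (q \o lift ord0) u.
  have : ev q (nseq d z ++ word_inv (up u)) = 1.
    by apply: q_rs; rewrite !mem_cat uxr !orbT.
  by rewrite ev_cat ev_inv ev_up ev_z => /divg1_eq.
pose W := flatten (nseq (k %/ d) u).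
pose V := if c then word_inv W else W.
have VE (M : groupType) (m : 'I_n.+1 -> M) :
    m ord0 ^+ d = ev (m \o lift ord0) u ->
  letter_val m (ord0, c) ^+ k = ev (m \o lift ord0) V.
  move=> mu; have WE : m ord0 ^+ k = ev (m \o lift ord0) W.
    rewrite -{1}(divnK dk) /W; elim: (k %/ d) => // e IHe.
    by rewrite mulSn expgnDr /= ev_cat -IHe mu.
  rewrite /V /letter_val; case: (c) => //=.
  by rewrite expVgn ev_inv WE.
move: bw1; rewrite !VE // -!ev_cat; exact: q_rs'.
Qed.

Lemma gen_cons_commute (G : groupType) (a : G) (s : seq G) x :
    {in a :: s &, forall y z, commute y z} -> gen [set` a :: s] x ->
  exists c k y, gen [set` s] y /\ x = (if c then a^-1 else a) ^+ k * y.
Proof.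
move=> cs; rewrite -(range_nth 1) => /gen_range [w <-].
have [c [k [w' wE]]] := commuting_word_split w.
rewrite wE => [|i]; last by apply: cs; rewrite mem_nth ?ltn_ord.
exists c, k; eexists; split; last by [].
rewrite -(range_nth 1); apply/gen_range; exists w'.
by congr (ev _ w'); apply/funext.
Qed.

(** Induction on the number of generators: modulo the subgroup generated by [s]
    the subgroup [S] becomes cyclic, generated by the class of an element
    [a ^+ d * y] with [d] least. *)
Lemma gen_commute_noetherian (G : groupType) (s : seq G) (S : set G) :
    {in s &, forall x y, commute x y} -> is_subgroup S ->
    S `<=` gen [set` s] ->
  exists l : seq G, S = gen [set` l].
Proof.
elim: s S => [|a s IHs] S cs SS Ssub; have [S1 SM SV] := SS.
  by exists [::]; apply/seteqP; split=> //; apply: gen_sub.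
have [g1 gM gV] := gen_subgroup [set` s].
have cs' : {in s &, forall x y, commute x y}.
  by move=> x y xs ys; apply: cs; rewrite inE (xs, ys) orbT.
have SX x n : S x -> S (x ^+ n).
  by move=> Sx; elim: n => // n IHn; rewrite expgS; apply: SM.
have gX x n : gen [set` s] x -> gen [set` s] (x ^+ n).
  by move=> gx; elim: n => // n IHn; rewrite expgS; apply: gM.
pose S' := S `&` gen [set` s].
have [l Sl] : exists l : seq G, S' = gen [set` l].
  apply: IHs => //; last by move=> x [].
  by split=> [|x y [Sx gx] [Sy gy]|x [Sx gx]]; split; auto.
have S'l x : S' x -> forall z, gen [set` z :: l] x.
  rewrite Sl => lx z; apply: genS lx => y /= yl.
  by rewrite inE yl orbT.
have sub_cons z : S z -> gen [set` z :: l] `<=` S.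
  move=> Sz; apply: gen_sub => // y; rewrite /= inE => /predU1P[->//|yl].
  suff: S' y by case.
  by rewrite Sl; apply: sub_gen.
(* Exponents are kept nonnegative at the price of an inversion. *)
have split_pos x : S x -> exists k y,
    gen [set` s] y /\ (x = a ^+ k * y \/ x^-1 = a ^+ k * y).
  move=> /Ssub/(gen_cons_commute cs) [c [k [y [gy ->]]]]; exists k.
  case: c; [exists y^-1|exists y]; split; auto; right.
  have cay : commute y^-1 (a ^+ k).
    apply/commuteX; apply: (gen_commute (A := [set` a :: s])) => //.
      apply: genS (gV _ gy) => z /= zs; by rewrite inE zs orbT.
    by apply: sub_gen; rewrite /= inE eqxx.
  by rewrite invgM expVgn invgK cay.
pose P k := exists y, gen [set` s] y /\ S (a ^+ k * y).
have acomm y k : gen [set` s] y -> commute y (a ^+ k).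
  move=> gy; apply/commuteX; apply: (gen_commute (A := [set` a :: s])) => //.
    by apply: genS gy => z /= zs; rewrite inE zs orbT.
  by apply: sub_gen; rewrite /= inE eqxx.
have Psub i j : P i -> P (i + j)%N -> P j.
  move=> [y [gy Sy]] [z [gz Sz]]; exists (y^-1 * z); split; first by auto.
  have -> : a ^+ j * (y^-1 * z) = (a ^+ i * y)^-1 * (a ^+ (i + j) * z).
    rewrite invgM expgnDr !mulgA; congr (_ * _); rewrite mulgVK.
    by apply/esym; apply: acomm; apply: gV.
  by auto.
have [[k [k0 Pk]]|noP] := pselect (exists k, 0 < k /\ P k)%N; last first.
  exists (1 :: l); apply/seteqP; split; last exact: sub_cons.
  move=> x Sx; apply: S'l; split=> //.
  have [k [y [gy [xE|xE]]]] := split_pos x Sx.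
    have [k0|k0] := posnP k; first by rewrite xE k0 expg0 mul1g.
    by case: noP; exists k; split=> //; exists y; rewrite -xE.
  have [k0|k0] := posnP k.
    by rewrite -[x]invgK xE k0 expg0 mul1g; auto.
  by case: noP; exists k; split=> //; exists y; rewrite -xE; auto.
have [d [d0 [y [gy Sy]] dmin]] := least_dividing Psub k0 Pk.
exists ((a ^+ d * y) :: l); apply/seteqP; split; last exact: sub_cons.
have [h1 hM hV] := gen_subgroup [set` (a ^+ d * y) :: l].
have main x m z : S x -> gen [set` s] z -> x = a ^+ m * z ->
    gen [set` (a ^+ d * y) :: l] x.
  move=> Sx gz xE; have dm : d %| m by apply: dmin; exists z; rewrite -xE.
  pose e := (m %/ d)%N.
  have tE : (a ^+ d * y) ^+ e = a ^+ m * y ^+ e.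
    by rewrite expgMn -?expgnA ?(mulnC d) ?divnK //; apply/commute_sym/acomm.
  have hX : gen [set` (a ^+ d * y) :: l] ((a ^+ d * y) ^+ e).
    elim: (e) => // n IHn; rewrite expgS; apply: hM => //.
    by apply: sub_gen; rewrite /= inE eqxx.
  rewrite -[x](mulVKg ((a ^+ d * y) ^+ e)); apply: hM => //.
  apply: S'l; split; first by auto.
  have -> : ((a ^+ d * y) ^+ e)^-1 * x = (y ^+ e)^-1 * z.
    by rewrite tE xE invgM -mulgA mulKg.
  by auto.
move=> x Sx; have [m [z [gz [xE|xE]]]] := split_pos x Sx.
  exact: main xE.
by rewrite -[x]invgK; apply: hV; apply: main xE; auto.
Qed.

(** * Groups acting on trees *)

Definition is_action (G : groupType) (T : Type) (act : G -> T -> T) :=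
  (forall x, act 1 x = x) /\
  (forall g h x, act (g * h) x = act g (act h x)).

Definition stab_coherent (G : groupType) (T : Type) (act : G -> T -> T) (y : T) :=
  forall k (b : 'I_k -> G), (forall i, act (b i) y = y) -> fin_related b.

Section Action.
Variables (G : groupType) (T : choiceType) (act : G -> T -> T).
Hypothesis actP : is_action act.

Lemma actVK g : cancel (act g) (act g^-1).
Proof. by move=> x; rewrite -actP.2 mulVg actP.1. Qed.

Lemma actKV g : cancel (act g^-1) (act g).
Proof. by move=> x; rewrite -actP.2 mulgV actP.1. Qed.

Lemma stab_subgroup y : is_subgroup [set g | act g y = y].
Proof.
split=> /= [|g h gy hy|g gy]; first exact: actP.1.
  by rewrite actP.2 hy.
by rewrite -{1}gy actVK.
Qed.

Lemma stab_coherent_act g y : stab_coherent act y -> stab_coherent act (act g y).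
Proof.
move=> coh k b bgy.
apply: (@fin_related_inj _ _ _ (fun x => x ^ g)).
- by move=> x z; apply: conjMg.
- by move=> x _ /eqP; rewrite conjg_eq1 => /eqP.
by apply: coh => i; rewrite /= conjgE !actP.2 bgy actVK.
Qed.

Definition groupoid n (D : T -> T -> set (word 'I_n)) :=
  [/\ forall x, D x x [::],
      forall x y z u v, D x y u -> D y z v -> D x z (v ++ u) &
      forall x y u, D x y u -> D y x (word_inv u)].

(** With F free on the letters, [ev a] maps F to G; let K be its image.  The
    elements of K carrying [x] to [y], for varying [x] and [y], form a groupoid.
    The part of it generated by the finite family [M] lifts to F / <<rs>> for some
    finite set [rs] of relations of [a]; [D x y] is the lift of its elements from
    [x] to [y].  To see this, choose a representative [r y] in each K-orbit and
    an element [t y] of K that carries it to [y].  The elements of [M] conjugated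
    by these transporters generate a subgroup in the stabilizer of each of
    finitely many representatives.  These subgroups are finitely related, and
    [rs] consists of their relators, expressed in the letters of [a]. *)
Lemma transporter_lift (x0 : T) n (a : 'I_n -> G) (M : seq (T * T * word 'I_n)) :
    {in M, forall m, act (ev a m.2) m.1.1 = m.1.2} ->
    {in M, forall m, stab_coherent act m.1.2} ->
  exists (rs : seq (word 'I_n)) (D : T -> T -> set (word 'I_n)),
  [/\ forall r, r \in rs -> ev a r = 1,
      groupoid D,
      [/\ forall x y u v, word_eq [set` rs] u v -> D x y u -> D x y v,
          forall x y u, D x y u -> act (ev a u) x = y &
          forall x u, D x x u -> ev a u = 1 -> word_eq [set` rs] u [::]] &
      {in M, forall m, D m.1.1 m.1.2 m.2}].
Proof.
move=> Mact Mcoh.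
pose orb y := [set z | exists w, z = act (ev a w) y].
(* [xget] picks the same element from equal sets, so [r] is constant on orbits. *)
pose r y := xget x0 (orb y).
have orb_r y : orb y (r y).
  by apply: (@xgetI _ _ _ y); exists [::]; rewrite actP.1.
have rE w y : r (act (ev a w) y) = r y.
  congr (xget _ _); apply/seteqP; split=> _ [w' ->].
    by exists (w' ++ w); rewrite ev_cat actP.2.
  by exists (w' ++ word_inv w); rewrite ev_cat actP.2 ev_inv actVK.
have /choice[t tE] : forall y, exists w, act (ev a w) (r y) = y.
  move=> y; have [w ->] := orb_r y.
  by exists (word_inv w); rewrite ev_inv actVK.
pose l x := [seq word_inv (t m.1.2) ++ m.2 ++ t m.1.1 | m <- M & r m.1.2 == x].
pose L x : 'I_(size (l x)) -> word 'I_n := fun i => nth [::] (l x) i.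
have Lfix x i : act (ev a (L x i)) x = x.
  have : L x i \in l x by apply: mem_nth.
  case/mapP=> -[[y' y] W]; rewrite mem_filter /= => /andP[/eqP rx mM] ->.
  have /= Wy := Mact _ mM; have ry : r y' = x by rewrite -rx -Wy rE.
  by rewrite !ev_cat !actP.2 -{1}ry tE Wy ev_inv -{2}(tE y) actVK.
(* Off the finitely many orbits met by M the lifted subgroup is trivial. *)
have l_nil x : x \notin [seq r m.1.2 | m <- M] -> forall w : word 'I_(size (l x)), w = [::].
  move=> xM; have l0 : l x = [::].
    apply/eqP; rewrite -size_eq0 size_map size_filter -leqn0 leqNgt -has_count.
    by apply/hasPn => m mM; apply: contra xM => /eqP<-; apply: map_f.
  by case=> [//|[i b] w]; have: i < size (l x) := ltn_ord i; rewrite {2}l0.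
have Lrel x : fin_related (fun i => ev a (L x i)).
  have [/mapP[m mM rx]|xM] := boolP (x \in [seq r m.1.2 | m <- M]).
    suff: stab_coherent act x by apply.
    have [w rw] := orb_r m.1.2; rewrite rx rw.
    exact/stab_coherent_act/Mcoh.
  exists [::] => w; rewrite [w]l_nil //; split=> // _; exact: weq_refl.
pose rsL x := sval (cid (Lrel x)).
have rsLP x w : ev (fun i => ev a (L x i)) w = 1 <-> word_eq [set` rsL x] w [::].
  by rewrite /rsL; case: cid.
pose rs := flatten [seq map (wsubst (L x)) (rsL x) | x <- [seq r m.1.2 | m <- M]].
have rs1 x : forall w, ev (fun i => ev a (L x i)) w = 1 ->
    word_eq [set` rs] (wsubst (L x) w) [::].
  move=> w; have [xM|xM] := boolP (x \in [seq r m.1.2 | m <- M]); last first.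
    by rewrite [w]l_nil // => _; apply: weq_refl.
  move/rsLP/word_eq_wsubst => /(_ _ (L x) [set` rs]); apply=> u urs.
  apply: weq_rel; apply/flattenP; exists (map (wsubst (L x)) (rsL x)).
    by apply/mapP; exists x.
  exact: map_f.
pose q := ev (pgen [set` rs]).
pose D x y : set (word 'I_n) := [set u | exists z, [/\ r x = z, r y = z &
  exists w : word 'I_(size (l z)), q u = q (t y) * q (wsubst (L z) w) * (q (t x))^-1]].
have rsa s : s \in rs -> ev a s = 1.
  case/flattenP=> _ /mapP[x xM ->] /mapP[u urs ->].
  by rewrite ev_wsubst; apply/rsLP/weq_rel.
have qa u v : q u = q v -> ev a u = ev a v.
  by move/word_eq_pgen/ev_word_eq; apply.
exists rs, D; split=> //.
- split.
  + move=> x; exists (r x); split=> //; exists [::].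
    by rewrite /q /= mulg1 mulgV.
  + move=> x y z u v [p [rx ry [w qu]]] [p' [ry' rz [w' qv]]].
    move: (ry') w' qv rz; rewrite ry => <- {p' ry'} w' qv rz.
    exists p; split=> //; exists (w' ++ w).
    by rewrite wsubst_cat /q !ev_cat -!/(q _) qu qv !mulgA mulgVK.
  + move=> x y u [p [rx ry [w qu]]]; exists p; split=> //; exists (word_inv w).
    by rewrite wsubst_inv /q !ev_inv -!/(q _) qu !invgM invgK !mulgA.
- split.
  + move=> x y u v /word_eq_pgen uv [p [rx ry [w qu]]]; exists p; split=> //.
    by exists w; rewrite -qu; apply/esym.
  + move=> x y u [p [rx ry [w qu]]].
    have -> : ev a u = ev a (t y ++ wsubst (L p) w ++ word_inv (t x)).
      by apply: qa; rewrite qu /q !ev_cat ev_inv mulgA.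
    rewrite !ev_cat !actP.2 ev_inv -{2}(tE x) actVK rx.
    have /= -> : [set g | act g p = p] (ev a (wsubst (L p) w)).
      by rewrite ev_wsubst; apply: ev_in (stab_subgroup _) _ => i; apply: Lfix.
    by rewrite -ry tE.
  + move=> x u [p [rx ry [w qu]]] au; apply/word_eq_pgen1; rewrite -/(q u) qu.
    have /rs1/word_eq_pgen1 : ev (fun i => ev a (L p i)) w = 1.
      rewrite -ev_wsubst; move: au.
      have -> : ev a u = ev a (t x ++ wsubst (L p) w ++ word_inv (t x)).
        by apply: qa; rewrite qu /q !ev_cat ev_inv mulgA.
      rewrite !ev_cat ev_inv => /mulg1_eq E.
      by apply: (@mulIg _ (ev a (t x))^-1); rewrite -E mul1g.
    by rewrite -/(q _) => ->; rewrite mulg1 mulgV.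
- move=> -[[y' y] W] mM /=; exists (r y); split=> //.
    by have /= <- := Mact _ mM; rewrite rE.
  have : word_inv (t y) ++ W ++ t y' \in l (r y).
    by apply/mapP; exists (y', y, W); rewrite // mem_filter mM eqxx.
  case/(nthP [::]) => i il Li; exists [:: (Ordinal il, false)].
  rewrite /= /L /= Li cats0 /q !ev_cat ev_inv !mulgA mulgV mul1g mulgK //.
Qed.

End Action.

Fixpoint walk (T : Type) (e : T -> T -> Prop) (x : T) (p : seq T) : Prop :=
  if p is y :: p' then e x y /\ walk e y p' else True.

Definition backtracks (T : Type) (p : seq T) :=
  exists p1 y z p2, p = p1 ++ [:: y, z, y & p2].

Lemma walk_cat (T : Type) (e : T -> T -> Prop) x p q :
  walk e x (p ++ q) <-> walk e x p /\ walk e (last x p) q.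
Proof.
elim: p x => [|y p IHp] x /=; first by split=> [|[]].
by rewrite IHp; split=> [[? []]|[[]]].
Qed.

Lemma walk_map (S T : Type) (f : S -> T) (e : S -> S -> Prop)
    (e' : T -> T -> Prop) x p :
  (forall y z, e y z -> e' (f y) (f z)) -> walk e x p -> walk e' (f x) (map f p).
Proof. by move=> ee'; elim: p x => //= y p IHp x [/ee' ? /IHp]. Qed.

Lemma backtracks_map (S T : Type) (f : S -> T) q p :
    backtracks (map f (q :: p)) ->
  exists r b c s, p = r ++ [:: b, c & s] /\ f (last q r) = f c.
Proof.
case=> s1 [y [z [s2]]]; elim: s1 q p => [|h s1 IHs] q p /=.
  by case: p => [|b [|c s]] //= [<- _ fc _]; exists [::], b, c, s.
case: p => [[_]|q' p [_]]; first by case: s1 {IHs}.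
by case/IHs=> r [b [c [s [-> E]]]]; exists (q' :: r), b, c, s.
Qed.

Section LocallyInjective.
Variables (Q T : Type) (f : Q -> T) (sim e : Q -> Q -> Prop).
Hypothesis sim_refl : forall q, sim q q.
Hypothesis sim_trans : forall q1 q2 q3, sim q1 q2 -> sim q2 q3 -> sim q1 q3.
Hypothesis sim_f : forall q1 q2, sim q1 q2 -> f q1 = f q2.
Hypothesis e_siml : forall q1 q2 q3, sim q1 q2 -> e q2 q3 -> e q1 q3.
Hypothesis e_inj : forall q0 q1 q2,
  e q0 q1 -> e q1 q2 -> f q0 = f q2 -> sim q0 q2.

Lemma walk_sim q q' p :
  sim q q' -> walk e q' p -> walk e q p /\ sim (last q p) (last q' p).
Proof.
move=> qq'; case: p => [//|y p] /= [q'y yp]; split=> //.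
by split=> //; apply: e_siml q'y.
Qed.

(** A walk with a closed image has a backtracking image, as the target is a tree;
    by local injectivity the walk itself then backtracks up to [sim], and the two
    superfluous steps can be removed. *)
Lemma locally_injective_walk q :
    (forall p, walk e q p -> f (last q p) = f q -> p <> [::] ->
       backtracks (map f (q :: p))) ->
  forall p, walk e q p -> f (last q p) = f q -> sim q (last q p).
Proof.
move=> tree p; have [n] := ubnP (size p); elim: n p => // n IHn p.
rewrite ltnS => pn qp fqp; have [->//|p0] := pselect (p = [::]).
have [r [b [c [s [pE rc]]]]] := backtracks_map (tree p qp fqp p0).
move: qp fqp pn; rewrite pE last_cat /= size_cat /= !addnS => qp fqp pn.
have [qr [rb [bc cs]]] : walk e q r /\ walk e (last q r) [:: b, c & s].
  exact/walk_cat.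
have [rs rcs] := walk_sim (e_inj rb bc rc) cs.
have rsE : last q (r ++ s) = last (last q r) s by rewrite last_cat.
apply: (sim_trans _ rcs); rewrite -rsE; apply: IHn.
- by rewrite size_cat (leq_trans _ pn) // ltnS leqnSn.
- exact/walk_cat.
- by rewrite rsE (sim_f rcs).
Qed.

End LocallyInjective.

Lemma seq_union_choice (A B : eqType) (Q : B -> Prop) (P : A -> seq B -> Prop)
    (s : seq A) :
    (forall x l l', {subset l <= l'} -> P x l -> P x l') ->
    {in s, forall x, exists l, {in l, forall b, Q b} /\ P x l} ->
  exists l, {in l, forall b, Q b} /\ {in s, forall x, P x l}.
Proof.
move=> Pmono; elim: s => [|x s IHs] H; first by exists [::].
have [|l [lQ lP]] := IHs; first by move=> y ys; apply: H; rewrite inE ys orbT.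
have [l' [lQ' lP']] := H x (mem_head _ _).
exists (l ++ l'); split=> [b|y]; first by rewrite mem_cat => /orP[/lQ|/lQ'].
rewrite inE => /predU1P[->|/lP Py].
  by apply: (Pmono _ l') => // b bl; rewrite mem_cat bl orbT.
by apply: (Pmono _ l) => // b bl; rewrite mem_cat bl.
Qed.

Lemma walk_finite_edges (T : eqType) (E : T -> T -> Prop) x p :
    walk E x p ->
  exists l : seq (T * T), {in l, forall e, E e.1 e.2} /\
    walk (fun y z => (y, z) \in l) x p.
Proof.
elim: p x => [|y p IHp] x /=; first by exists [::].
move=> [xy /IHp[l [lE lp]]]; exists ((x, y) :: l); split=> [e|].
  by rewrite inE => /predU1P[->|/lE].
split; first exact: mem_head.
rewrite -(map_id p); apply: walk_map lp => u v uv.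
by rewrite inE uv orbT.
Qed.

Section TreeAction.
Variables (G : groupType) (T : choiceType) (act : G -> T -> T).
Variables (E : T -> T -> Prop) (x0 : T).
Hypothesis actP : is_action act.
Hypothesis E_act : forall g x y, E x y -> E (act g x) (act g y).
Hypothesis conn : forall g, exists p, walk E x0 p /\ last x0 p = act g x0.
Hypothesis no_cycle : forall p,
  walk E x0 p -> last x0 p = x0 -> p <> [::] -> backtracks (x0 :: p).
Hypothesis root_stab : stab_coherent act x0.
Hypothesis vertex_stab : forall x y,
  E x y -> stab_coherent act x /\ stab_coherent act y.
Hypothesis edge_stab : forall x y (S : set G), E x y -> is_subgroup S ->
  (forall g, S g -> act g x = x /\ act g y = y) ->
  exists l : seq G, S = gen [set` l].

(** The elements carrying one edge to another, if any, form a coset of the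
    stabilizer of an edge.  This stabilizer is finitely generated, so that finitely many elements
    [M] generate all these transporters as a groupoid, simultaneously at both
    ends of the edges.  This is what makes the map from the lifted graph to the
    tree locally injective. *)
Lemma edge_transporters n (a : 'I_n -> G) y z y' z' :
    E y z ->
  exists M : seq (T * T * word 'I_n),
    {in M, forall m, act (ev a m.2) m.1.1 = m.1.2 /\ stab_coherent act m.1.2} /\
    forall D, groupoid D -> {in M, forall m, D m.1.1 m.1.2 m.2} ->
    forall k, act (ev a k) y' = y -> act (ev a k) z' = z ->
      exists w, [/\ D y' y w, D z' z w & ev a w = ev a k].
Proof.
move=> Eyz; have [cy cz] := vertex_stab Eyz.
have [[k0 [k0y k0z]]|noK] := pselect (exists k, act (ev a k) y' = y /\
    act (ev a k) z' = z); last first.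
  by exists [::]; split=> // D _ _ k ky kz; case: noK; exists k.
pose S := gen (range a) `&` ([set g | act g y = y] `&` [set g | act g z = z]).
have [A1 AM AV] := gen_subgroup (range a).
have [Y1 YM YV] := stab_subgroup actP y.
have [Z1 ZM ZV] := stab_subgroup actP z.
have SS : is_subgroup S.
  split=> [//|g h [ga [gy gz]] [ha [hy hz]]|g [ga [gy gz]]].
    by split; [apply: AM|split; [apply: YM|apply: ZM]].
  by split; [apply: AV|split; [apply: YV|apply: ZV]].
have [l lS] : exists l : seq G, S = gen [set` l].
  by apply: (edge_stab Eyz SS) => g [_ []].
have lP g : g \in l -> S g by move=> gl; rewrite lS; apply: sub_gen.
have /choice[om omP] : forall g, exists w, g \in l -> ev a w = g.
  move=> g; have [/lP[/gen_range[w <-] _]|_] := boolP (g \in l).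
    by exists w.
  by exists [::].
exists ([:: (y', y, k0); (z', z, k0)] ++
   [seq (y, y, om g) | g <- l] ++ [seq (z, z, om g) | g <- l]); split.
  move=> m; rewrite !mem_cat !inE -orbA => /or4P[/eqP->|/eqP->||] //=.
    by case/mapP=> g gl -> /=; rewrite omP //; have [_ []] := lP g gl.
  by case/mapP=> g gl -> /=; rewrite omP //; have [_ []] := lP g gl.
move=> D [D1 DM DV] MD k ky kz.
have Dk : D y' y k0 /\ D z' z k0.
  by split; [apply: (MD (y', y, k0))|apply: (MD (z', z, k0))];
     rewrite !mem_cat !inE eqxx ?orbT.
have : gen [set` l] (ev a k * (ev a k0)^-1).
  rewrite -lS; split.
    apply: AM; first by apply/gen_range; exists k.
    by apply: AV; apply/gen_range; exists k0.
  by split; rewrite /= actP.2; [rewrite -{1}k0y|rewrite -{1}k0z]; rewrite actVK.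
have sub : gen [set` l] `<=` [set g | exists w, [/\ D y y w, D z z w & ev a w = g]].
  apply: gen_sub => [|g /= gl].
    split=> [|_ _ [u [uy uz <-]] [v [vy vz <-]]|_ [u [uy uz <-]]].
    - by exists [::].
    - by exists (u ++ v); split; [apply: DM vy uy|apply: DM vz uz|rewrite ev_cat].
    - by exists (word_inv u); split; [apply: DV|apply: DV|rewrite ev_inv].
  exists (om g); split; last exact: omP.
    by apply: (MD (y, y, om g)); rewrite !mem_cat !inE (map_f (fun g => (y, y, om g))) ?orbT.
  by apply: (MD (z, z, om g)); rewrite !mem_cat !inE (map_f (fun g => (z, z, om g))) ?orbT.
move/sub => [w [wy wz wE]]; exists (w ++ k0); split.
- by apply: DM wy; case: Dk.
- by apply: DM wz; case: Dk.
- by rewrite ev_cat wE mulgVK.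
Qed.

(** The lifted graph has the pairs [(u, y)] as vertices, with [u] an element of the
    free group, standing for the translate of [y] by [u]; [sim] says that two pairs
    name the same vertex. *)
Theorem tree_tuple_coherent : tuple_coherent G.
Proof.
move=> n a.
have [Ed [EdE EdP]] : exists Ed : seq (T * T), {in Ed, forall e, E e.1 e.2} /\
    {in enum {: 'I_n * bool}, forall l, exists p,
      walk (fun y z => (y, z) \in Ed) x0 p /\ last x0 p = act (letter_val a l) x0}.
  apply: seq_union_choice => [l s s' ss' [p [sp pl]]|l _].
    exists p; split=> //; rewrite -(map_id p); apply: walk_map sp => u v.
    exact: ss'.
  have [p [Ep pl]] := conn (letter_val a l).
  by have [s [sE sp]] := walk_finite_edges Ep; exists s; split=> //; exists p.
pose Q (m : T * T * word 'I_n) :=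
  act (ev a m.2) m.1.1 = m.1.2 /\ stab_coherent act m.1.2.
have walk_stab x p : walk E x p -> stab_coherent act x -> stab_coherent act (last x p).
  elim: p x => //= y p IHp x [xy yp] _; apply: IHp => //.
  by have [] := vertex_stab xy.
pose P (ee : (T * T) * (T * T)) (M : seq (T * T * word 'I_n)) :=
  forall D, groupoid D -> {in M, forall m, D m.1.1 m.1.2 m.2} ->
  forall k, act (ev a k) ee.2.2 = ee.1.1 -> act (ev a k) ee.2.1 = ee.1.2 ->
  exists w, [/\ D ee.2.2 ee.1.1 w, D ee.2.1 ee.1.2 w & ev a w = ev a k].
have [M1 [M1Q M1P]] : exists M, {in M, forall m, Q m} /\
    {in [seq (e1, e2) | e1 <- Ed, e2 <- Ed], forall ee, P ee M}.
  apply: seq_union_choice => [ee M M' MM' H D gD M'D|ee].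
    by apply: H => // m /MM'; apply: M'D.
  case/allpairsP=> -[[y z] [z2 y2]] /= [e1 e2 ->].
  exact: (edge_transporters a y2 z2 (EdE _ e1)).
pose M2 := [seq (x0, act (letter_val a l) x0, [:: l]) | l <- enum {: 'I_n * bool}].
have M2Q : {in M2, forall m, Q m}.
  move=> _ /mapP[l _ ->]; split; first by rewrite /= mulg1.
  by have [p [Ep <-]] := conn (letter_val a l); apply: walk_stab Ep root_stab.
have MQ : {in M1 ++ M2, forall m, Q m}.
  by move=> m; rewrite mem_cat => /orP[/M1Q|/M2Q].
have [||rs [D [rs1 gD [Deq Dact Dinj] MD]]] :=
    transporter_lift actP (a := a) (M := M1 ++ M2) x0.
- by move=> m /MQ[].
- by move=> m /MQ[].
have [D1 DM DV] := gD.
exists rs => w; split; last by move/(ev_word_eq rs1).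
pose f (q : word 'I_n * T) := act (ev a q.1) q.2.
pose sim (q q' : word 'I_n * T) := D q'.2 q.2 (word_inv q.1 ++ q'.1).
pose e (q q' : word 'I_n * T) := exists u y z,
  [/\ (y, z) \in Ed, sim q (u, y) & sim (u, z) q'].
have simD q q' u : D q'.2 q.2 u -> word_eq [set` rs] (q.1 ++ u) q'.1 -> sim q q'.
  move=> Du uq; apply: Deq Du; rewrite -[u]cats0.
  apply/word_eq_pgen; rewrite !ev_cat ev_inv /= mulg1.
  by apply/(mulgI (ev (pgen [set` rs]) q.1)); rewrite mulVKg -ev_cat; apply/word_eq_pgen.
have sim_refl q : sim q q.
  by apply: (simD _ _ [::]) => //; rewrite cats0; apply: weq_refl.
have sim_trans q1 q2 q3 : sim q1 q2 -> sim q2 q3 -> sim q1 q3.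
  move=> q12 q23; apply: (simD _ _ _ (DM _ _ _ _ _ q23 q12)).
  apply/word_eq_pgen; rewrite !ev_cat !ev_inv.
  by rewrite -!mulgA !mulVKg.
have sim_f q1 q2 : sim q1 q2 -> f q1 = f q2.
  move/Dact; rewrite ev_cat ev_inv actP.2 /f => <-.
  by rewrite actKV.
have e_siml q1 q2 q3 : sim q1 q2 -> e q2 q3 -> e q1 q3.
  by move=> q12 [u [y [z [yz q2u uq3]]]]; exists u, y, z; split=> //; apply: sim_trans q2u.
have e_inj q0 q1 q2 : e q0 q1 -> e q1 q2 -> f q0 = f q2 -> sim q0 q2.
  move=> [u [y [z [yz q0u uq1]]]] [u2 [z2 [y2 [zy2 q1u2 u2q2]]]] f02.
  apply: (sim_trans _ _ _ q0u); apply: (sim_trans _ _ _ _ u2q2).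
  have zz2 : sim (u, z) (u2, z2) := sim_trans _ _ _ uq1 q1u2.
  pose k := word_inv u ++ u2.
  have kz : act (ev a k) z2 = z := Dact _ _ _ zz2.
  have ky : act (ev a k) y2 = y.
    have : f (u, y) = f (u2, y2) by rewrite -(sim_f _ _ q0u) f02 -(sim_f _ _ u2q2).
    by rewrite /f /= /k ev_cat ev_inv actP.2 => <-; rewrite actVK.
  have M1D : {in M1, forall m, D m.1.1 m.1.2 m.2}.
    by move=> m mM; apply: MD; rewrite mem_cat mM.
  have [|v [vy vz vk]] := M1P ((y, z), (z2, y2)) _ D gD M1D k ky kz.
    by apply/allpairsP; exists ((y, z), (z2, y2)).
  apply: Deq vy; apply/word_eq_quot/(Dinj z2).
    by apply: DM zz2 _; apply: DV vz.
  by rewrite ev_cat ev_inv vk mulVg.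
(* The lifted graph is connected, as M2 lifts the letters. *)
have conn_hat u : exists p, walk e ([::], x0) p /\ sim (last ([::], x0) p) (u, x0).
  elim/last_ind: u => [|u l [p [ep pu]]]; first by exists [::].
  have [|p' [Ep' p'l]] := EdP l; first by rewrite mem_enum.
  have ep' : walk e (u, x0) (map (pair u) p').
    by apply: walk_map Ep' => y z yz; exists u, y, z.
  have [ep'' pp''] := walk_sim sim_refl e_siml pu ep'.
  exists (p ++ map (pair u) p'); split; first exact/walk_cat.
  rewrite last_cat; apply: (sim_trans _ _ _ pp''); rewrite last_map p'l.
  apply: (simD _ _ [:: l]); last by rewrite cats1; apply: weq_refl.
  apply: (MD (x0, act (letter_val a l) x0, [:: l])).
  by rewrite mem_cat (map_f (fun l => (x0, _, [:: l]))) ?orbT // mem_enum.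
move=> w1; have [p [ep pw]] := conn_hat w.
have f0 : f ([::], x0) = x0 by apply: actP.1.
have fp : f (last ([::], x0) p) = f ([::], x0).
  by rewrite (sim_f _ _ pw) /f /= w1.
have : sim ([::], x0) (last ([::], x0) p).
  apply: (locally_injective_walk sim_refl sim_trans sim_f e_siml e_inj) ep fp.
  move=> p' ep' fp' p'0; rewrite /= f0; apply: no_cycle.
  - rewrite -f0; apply: walk_map ep' => q q' [u [y [z [yz qu uq']]]].
    by rewrite (sim_f _ _ qu) -(sim_f _ _ uq'); apply/E_act/(EdE _ yz).
  - by rewrite -f0 last_map fp'.
  - by case: p' p'0 {ep' fp'}.
by move/sim_trans => /(_ _ pw)/Dinj; apply.
Qed.

End TreeAction.

(** * Amalgams recognized by ping-pong *)

Definition shift (G : groupType) (g : G) (S : set G) : set G :=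
  [set x | S (g^-1 * x)].

Lemma shift_action (G : groupType) : is_action (@shift G).
Proof.
split=> [S|g h S]; apply/funext => x; rewrite /shift /=.
  by rewrite invg1 mul1g.
by rewrite invgM mulgA.
Qed.

Lemma shift_fix (G : groupType) (S : set G) g :
  is_subgroup S -> shift g S = S <-> S g.
Proof.
move=> [S1 SM SV]; split=> [gS|Sg].
  by rewrite -gS /shift /= mulVg.
apply/seteqP; split=> x; rewrite /shift /= => Sx; last by apply: SM => //; apply: SV.
by rewrite -[x](mulVKg g); apply: SM.
Qed.

(** The hypotheses [pongC] and [pongH] express that [G] is the amalgam of [H] and
    [C] over their intersection: an alternating product of elements off the
    intersection moves [eps] into [Y] or stays out of [Y] according to the side of
    its first factor.  The vertices [vH] and [vC] are the base points of the
    Bass-Serre tree, whose vertices are left cosets tagged by a boolean. *)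
Section PingPong.
Variables (G : groupType) (H C : set G) (P : Type) (act : G -> P -> P).
Variables (eps : P) (Y : set P).
Hypothesis H_subgroup : is_subgroup H.
Hypothesis C_subgroup : is_subgroup C.
Hypothesis HC_gen : forall g, gen (H `|` C) g.
Hypothesis actP : is_action act.
Hypothesis eps_fix : forall h, H h -> act h eps = eps.
Hypothesis epsY : ~ Y eps.
Hypothesis pongC : forall c p, C c -> ~ H c -> ~ Y p -> Y (act c p).
Hypothesis pongH : forall h p, H h -> ~ C h -> Y p -> ~ Y (act h p).

Definition coset_act (g : G) (x : set G * bool) := (shift g x.1, x.2).
Definition vH : set G * bool := (H, false).
Definition vC : set G * bool := (C, true).
Definition coset_edge (x y : set G * bool) := exists g,
  x = coset_act g vH /\ y = coset_act g vC \/
  x = coset_act g vC /\ y = coset_act g vH.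

Lemma coset_actP : is_action coset_act.
Proof.
split=> [[S b]|g h [S b]]; rewrite /coset_act /=.
  by rewrite (shift_action G).1.
by rewrite (shift_action G).2.
Qed.

Lemma coset_act_vH g : coset_act g vH = vH <-> H g.
Proof. by rewrite -(shift_fix g H_subgroup); split=> [[]|gS] //; rewrite /coset_act /= gS. Qed.

Lemma coset_act_vC g : coset_act g vC = vC <-> C g.
Proof. by rewrite -(shift_fix g C_subgroup); split=> [[]|gS] //; rewrite /coset_act /= gS. Qed.

Lemma coset_act_eq g h x :
  coset_act g x = coset_act h x <-> coset_act (g^-1 * h) x = x.
Proof.
rewrite coset_actP.2; split=> [<-|E]; first by rewrite (actVK coset_actP).
by rewrite -{1}E (actKV coset_actP).
Qed.

Lemma coset_edge_act g x y :
  coset_edge x y -> coset_edge (coset_act g x) (coset_act g y).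
Proof.
by move=> [h [[-> ->]|[-> ->]]]; exists (g * h); rewrite !coset_actP.2; [left|right].
Qed.

Lemma coset_conn g :
  exists p, walk coset_edge vH p /\ last vH p = coset_act g vH.
Proof.
pose K := [set g | exists p, walk coset_edge vH p /\ last vH p = coset_act g vH].
have KH g' h : K g' -> H h -> K (g' * h).
  move=> [p [pw pl]] Hh; exists p; split=> //.
  by rewrite pl coset_actP.2 (coset_act_vH h).2.
have KC g' c : K g' -> C c -> K (g' * c).
  move=> [p [pw pl]] Cc.
  exists (p ++ [:: coset_act g' vC; coset_act (g' * c) vH]); split.
    apply/walk_cat; split=> //; rewrite pl; split; first by exists g'; left.
    split=> //; exists (g' * c); right; split=> //.
    by rewrite coset_actP.2 (coset_act_vC c).2.
  by rewrite last_cat.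
have [_ _ HV] := H_subgroup; have [_ _ CV] := C_subgroup.
pose S := [set h | forall g', K g' -> K (g' * h) /\ K (g' * h^-1)].
have SS : is_subgroup S.
  split=> [g' Kg'|h k Sh Sk g' Kg'|h Sh g' Kg'].
  - by rewrite invg1 mulg1.
  - rewrite invgM !mulgA; split; first by apply Sk; apply Sh.
    by apply Sh; apply Sk.
  - by rewrite invgK; split; apply Sh.
have : S g.
  apply: gen_sub SS _ _ (HC_gen g) => h [Hh|Ch] g' Kg'.
    by split; apply: KH => //; apply: HV.
  by split; apply: KC => //; apply: CV.
case/(_ 1); first by exists [::]; rewrite coset_actP.1.
by rewrite mul1g.
Qed.

(** For a walk without backtracking that ends at [vH], the first edge, say the
    translate by [g] of the base edge, is recorded by [Y]: consecutive edges differ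
    by an element of [H] off [C] or of [C] off [H], and such elements play
    ping-pong.  As the walk is read towards its end, it is [g^-1] that acts. *)
Lemma reduced_walk_pong x y p :
    walk coset_edge x (y :: p) -> last y p = vH -> ~ backtracks [:: x, y & p] ->
  exists g, [/\ x = coset_act g vH, y = coset_act g vC & Y (act g^-1 eps)] \/
            [/\ x = coset_act g vC, y = coset_act g vH & ~ Y (act g^-1 eps)].
Proof.
elim: p x y => [|z p IHp] x y /= [].
  move=> [g [[-> ->]|[-> ->]]] _ // /coset_act_vH Hg _; exists g; right; split=> //.
  by rewrite eps_fix //; have [_ _ HV] := H_subgroup; apply: HV.
move=> [g xy] yz zl nb.
have [|g' [[yg' zg' Yg']|[yg' zg' Yg']]] := IHp y z yz zl.
- by move=> [p1 [u [v [p2 E]]]]; apply: nb; exists (x :: p1), u, v, p2; rewrite E.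
- case: xy => -[xg yg]; first by move: yg; rewrite yg'.
  exists g; right; split=> //.
  have /coset_act_eq/coset_act_vH Hh : coset_act g vH = coset_act g' vH by rewrite -yg.
  have -> : act g^-1 eps = act (g^-1 * g') (act g'^-1 eps).
    by rewrite -actP.2 mulgK.
  apply: pongH => // Ch; apply: nb; exists [::], x, y, p; congr [:: _, _, _ & _].
  rewrite zg' xg; apply/coset_act_eq/coset_act_vC.
  by rewrite -[_ * _]invgK invgM invgK; have [_ _] := C_subgroup; apply.
- case: xy => -[xg yg]; last by move: yg; rewrite yg'.
  exists g; left; split=> //.
  have /coset_act_eq/coset_act_vC Cc : coset_act g vC = coset_act g' vC by rewrite -yg.
  have -> : act g^-1 eps = act (g^-1 * g') (act g'^-1 eps).
    by rewrite -actP.2 mulgK.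
  apply: pongC => // Hc; apply: nb; exists [::], x, y, p; congr [:: _, _, _ & _].
  rewrite zg' xg; apply/coset_act_eq/coset_act_vH.
  by rewrite -[_ * _]invgK invgM invgK; have [_ _] := H_subgroup; apply.
Qed.

Lemma coset_no_cycle p : walk coset_edge vH p -> last vH p = vH -> p <> [::] ->
  backtracks (vH :: p).
Proof.
case: p => // y p pw pl _; apply: contrapT => nb.
have [g [[xg _ Yg]|[]//]] := reduced_walk_pong pw pl nb.
apply: epsY; rewrite -(eps_fix (h := g^-1)) //.
have [_ _ HV] := H_subgroup; apply: HV.
exact/coset_act_vH.
Qed.

Theorem amalgam_tuple_coherent :
    (forall n (a : 'I_n -> G), (forall i, H (a i)) -> fin_related a) ->
    (exists s : seq G, {in s &, forall x y, commute x y} /\ C = gen [set` s]) ->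
  tuple_coherent G.
Proof.
move=> Hcoh [s [cs CE]].
have stH : stab_coherent coset_act vH.
  by move=> k b bH; apply: Hcoh => i; apply/coset_act_vH.
have stC : stab_coherent coset_act vC.
  move=> k b bC; apply: fin_related_abelian => i j.
  by apply: (gen_commute (A := [set` s])) => //; rewrite -CE; apply/coset_act_vC.
apply: (@tree_tuple_coherent _ _ coset_act coset_edge vH) => //.
- exact: coset_actP.
- exact: coset_edge_act.
- exact: coset_conn.
- exact: coset_no_cycle.
- by move=> x y [g [[-> ->]|[-> ->]]]; split; apply: (stab_coherent_act coset_actP).
move=> x y S [g xy] SS Sxy.
have Sg k : S k -> coset_act k (coset_act g vC) = coset_act g vC.
  by move/Sxy => [kx ky]; case: xy kx ky => -[-> ->].
apply: (@gen_commute_noetherian _ [seq x ^ g^-1 | x <- s]) => //.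
  move=> _ _ /mapP[u us ->] /mapP[v vs ->].
  by rewrite /commute -!conjMg; congr (_ ^ _); apply: cs.
move=> k Sk; rewrite -[k](conjgK g); apply: (@gen_morph _ _ (fun x => x ^ g^-1) [set` s]).
- by move=> u v; apply: conjMg.
- by move=> u us; apply: sub_gen; apply: map_f.
rewrite -CE; apply/coset_act_vC; rewrite conjgE !coset_actP.2 Sg //.
exact: (actVK coset_actP).
Qed.

End PingPong.

(** * The group of bijections of a type *)

Record bijection (T : Type) := Bijection {
  bij_fun :> T -> T;
  bij_inv : T -> T;
  bij_funK : cancel bij_fun bij_inv;
  bij_invK : cancel bij_inv bij_fun }.

HB.instance Definition _ (T : Type) := gen_eqMixin (bijection T).
HB.instance Definition _ (T : Type) := gen_choiceMixin (bijection T).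

Section Bijections.
Variable T : Type.
Implicit Types f g h : bijection T.

Lemma bijectionP f g : f =1 g -> f = g.
Proof.
case: f g => [f f' fK f'K] [g g' gK g'K] /= fg.
have {}fg : f = g by apply/funext.
subst g; have fg' : f' = g' by apply/funext => x; rewrite -{1}(g'K x) fK.
by subst g'; congr Bijection; apply: Prop_irrelevance.
Qed.

Definition bij_one := @Bijection T id id (fun _ => erefl) (fun _ => erefl).
Definition bij_mul f g := Bijection
  (can_comp (bij_funK f) (bij_funK g)) (can_comp (bij_invK g) (bij_invK f)).
Definition bij_opp f := Bijection (bij_invK f) (bij_funK f).

Lemma bij_mulA : associative bij_mul. Proof. by move=> f g h; apply: bijectionP. Qed.
Lemma bij_mul1 : left_id bij_one bij_mul. Proof. by move=> f; apply: bijectionP. Qed.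
Lemma bij_mulr1 : right_id bij_one bij_mul. Proof. by move=> f; apply: bijectionP. Qed.
Lemma bij_mulV : left_inverse bij_one bij_opp bij_mul.
Proof. by move=> f; apply: bijectionP; apply: bij_funK. Qed.
Lemma bij_mulrV : right_inverse bij_one bij_opp bij_mul.
Proof. by move=> f; apply: bijectionP; apply: bij_invK. Qed.

HB.instance Definition _ := isGroup.Build (bijection T)
  bij_mulA bij_mul1 bij_mulr1 bij_mulV bij_mulrV.

End Bijections.

Lemma action_bijection (G : groupType) (T : Type) (act : G -> T -> T) :
    is_action act ->
  exists f : G -> bijection T, {morph f : x y / x * y} /\ forall g, f g =1 act g.
Proof.
move=> actP; have K g : cancel (act g) (act g^-1).
  by move=> x; rewrite -actP.2 mulVg actP.1.
have K' g : cancel (act g^-1) (act g).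
  by move=> x; rewrite -actP.2 mulgV actP.1.
exists (fun g => Bijection (K g) (K' g)); split=> // g h.
by apply: bijectionP => x; apply: actP.2.
Qed.

(** * Reduced words in a free product of copies of a group *)

(** A letter [(x, b)] is the element [b] of the copy of [B] indexed by [x].  The
    indices range over all subsets of [H], on which [H] acts by translation, rather
    than over the cosets of [A] alone; the orbit of the empty word only involves
    these cosets.  The group [B] acts through its copy of index [A]. *)
Section ReducedWords.
Variables (H B : groupType) (A : set H).
Hypothesis A_subgroup : is_subgroup A.

Definition reduced (p : seq (set H * B)) :=
  all (fun l => l.2 != 1) p && sorted (fun k l => k.1 != l.1) p.

Definition starts (p : seq (set H * B)) := if p is l :: _ then l.1 == A else false.
(** A word splits uniquely into an element of the copy of index [A], possibly
    trivial, and a word that does not start in that copy; multiplication on the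
    left acts on the first part, which makes it an action at once. *)
Definition head_letter (p : seq (set H * B)) :=
  if p is l :: _ then if l.1 == A then l.2 else 1 else 1.
Definition tail_word (p : seq (set H * B)) :=
  if p is l :: p' then if l.1 == A then p' else p else [::].
Definition prepend (b : B) (p : seq (set H * B)) :=
  if b == 1 then p else (A, b) :: p.

Lemma reduced_tail p : reduced p -> reduced (tail_word p) && ~~ starts (tail_word p).
Proof.
case: p => [//|[x b] p] /=; case: eqVneq => [->|xA] rp; last by rewrite rp.
move: rp; rewrite /reduced /= => /andP[/andP[b1 ->] pA] /=.
by case: p pA => //= l p /andP[Al ->]; rewrite eq_sym.
Qed.

Lemma reduced_prepend b p : reduced p && ~~ starts p -> reduced (prepend b p).
Proof.
rewrite /prepend => /andP[rp np]; case: eqVneq => // b1.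
move: rp; rewrite /reduced /= b1 /= => /andP[-> rp] /=.
by case: p np rp => //= l p; rewrite eq_sym => ->.
Qed.

Lemma prepend_head_tail p : reduced p -> prepend (head_letter p) (tail_word p) = p.
Proof.
rewrite /prepend; case: p => [|[x b] p] /=; first by rewrite eqxx.
case: (eqVneq x A) => [->|_]; last by rewrite eqxx.
by rewrite /reduced /= => /andP[/andP[/negPf->]].
Qed.

Lemma head_prepend b p : ~~ starts p -> head_letter (prepend b p) = b.
Proof.
rewrite /prepend; case: eqVneq => [->|_] /=; last by rewrite eqxx.
by case: p => //= l p /negPf->.
Qed.

Lemma tail_prepend b p : ~~ starts p -> tail_word (prepend b p) = p.
Proof.
rewrite /prepend; case: eqVneq => [_|_] /=; last by rewrite eqxx.
by case: p => //= l p /negPf->.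
Qed.

Definition lmul b p := prepend (b * head_letter p) (tail_word p).
Definition relabel h (p : seq (set H * B)) := [seq (shift h l.1, l.2) | l <- p].

Lemma shift_eq h (x y : set H) : (shift h x == shift h y) = (x == y).
Proof. by apply: inj_eq; apply: can_inj (actVK (shift_action H) h). Qed.

Lemma shift_eqA h (x : set H) : A h -> (shift h x == A) = (x == A).
Proof. by move=> Ah; rewrite -{1}((shift_fix h A_subgroup).2 Ah) shift_eq. Qed.

Lemma reduced_lmul b p : reduced p -> reduced (lmul b p).
Proof. by move/reduced_tail/reduced_prepend; apply. Qed.

Lemma reduced_relabel h p : reduced p -> reduced (relabel h p).
Proof.
rewrite /reduced all_map => /andP[-> sp] /=; rewrite sorted_map.
by apply: sub_sorted sp => k l /=; rewrite shift_eq.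
Qed.

Lemma starts_relabel h p : starts p -> starts (relabel h p) = `[< A h >].
Proof.
case: p => //= l p /eqP->; apply/eqP/asboolP; rewrite (shift_fix h A_subgroup) //.
Qed.

Lemma starts_relabelA h p : A h -> starts (relabel h p) = starts p.
Proof. by move=> Ah; case: p => //= l p; rewrite shift_eqA. Qed.

Lemma starts_lmul b p : ~~ starts p -> b != 1 -> starts (lmul b p).
Proof.
move=> np b1; have -> : lmul b p = (A, b) :: p; last by rewrite /= eqxx.
rewrite /lmul; case: p np => [|l p] /=; rewrite /prepend ?mulg1 ?(negPf b1) //.
by move=> /negPf->; rewrite mulg1 (negPf b1).
Qed.

(** The two actions commute over [A], as an amalgam over [A] requires. *)
Lemma relabel_lmul h b p : A h -> relabel h (lmul b p) = lmul b (relabel h p).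
Proof.
move=> Ah; have hA : shift h A = A by apply/shift_fix.
have pre c q : relabel h (prepend c q) = prepend c (relabel h q).
  by rewrite /prepend; case: eqP => //= _; rewrite hA.
rewrite /lmul pre; case: p => [|l p] //=; rewrite shift_eqA //.
by case: eqP.
Qed.

Definition rword := {p : seq (set H * B) | reduced p}.
Definition rword_lmul b (p : rword) : rword :=
  exist (fun p => reduced p) _ (reduced_lmul b (svalP p)).
Definition rword_relabel h (p : rword) : rword :=
  exist (fun p => reduced p) _ (reduced_relabel h (svalP p)).

Lemma rword_lmul_action : is_action rword_lmul.
Proof.
split=> [p|b c p]; apply: val_inj => /=.
  by rewrite /lmul mul1g prepend_head_tail //; exact: (svalP p).
have /andP[_ nt] := reduced_tail (svalP p).
by rewrite /lmul head_prepend // tail_prepend // mulgA.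
Qed.

Lemma rword_relabel_action : is_action rword_relabel.
Proof.
have [s1 sM] := shift_action H.
split=> [p|g h p]; apply: val_inj => /=; rewrite /relabel.
  by rewrite -[RHS]map_id; apply: eq_map => -[x b]; rewrite /= s1.
by rewrite -map_comp; apply: eq_map => -[x b]; rewrite /= sM.
Qed.

End ReducedWords.

(** * Graph products *)

Section GraphProductTheory.
Variables (V : finType) (E : rel V) (phi : V -> groupType).
Let G := graph_product E phi.

Definition vertex_elt (v : V) (g : phi v) : G :=
  pgen _ (Tagged (fun v => phi v : Type) g).

Lemma vertex_eltM v : {morph @vertex_elt v : g h / g * h}.
Proof.
move=> g h; have : ev (pgen _) [:: letter g false; letter h false; letter (g * h) true]
    = 1 :> G.
  by apply/word_eq_pgen1/weq_rel; left; exists v, g, h.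
by rewrite /= /letter_val /= mulg1 mulgA => /divg1_eq ->.
Qed.

Lemma vertex_elt_commute u v (g : phi u) (h : phi v) :
  E u v -> commute (vertex_elt g) (vertex_elt h).
Proof.
move=> uv; have : ev (pgen _) [:: letter g true; letter h true; letter g false; letter h false]
    = 1 :> G.
  by apply/word_eq_pgen1/weq_rel; right; exists u, v, g, h.
rewrite /= /letter_val /= mulg1 mulgA -invgM => /mulg1_eq; rewrite invgK => E'.
exact/esym.
Qed.

Lemma graph_product_gen (S : set G) :
  is_subgroup S -> (forall v (g : phi v), S (vertex_elt g)) -> forall x, S x.
Proof.
move=> SS Sv x; rewrite -[x]reprK -ev_pgen.
by apply: ev_in SS _ => -[v g]; apply: Sv.
Qed.

Lemma graph_product_lift (M : groupType) (f : forall v, phi v -> M) :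
    (forall v, {morph f v : g h / g * h}) ->
    (forall u v (g : phi u) (h : phi v), E u v -> commute (f u g) (f v h)) ->
  exists F : G -> M, {morph F : x y / x * y} /\
    forall v (g : phi v), F (vertex_elt g) = f v g.
Proof.
move=> fM fE; pose a (x : {v : V & phi v}) := f (tag x) (tagged x).
have rel1 r : (@free_product_relators V phi `|` @edge_relators V E phi) r -> ev a r = 1.
  case=> [[v [g [h ->]]]|[u [v [g [h [uv ->]]]]]]; rewrite /= /letter_val /a /=.
    by rewrite mulg1 fM mulgA mulgV.
  by rewrite mulg1 mulgA -invgM -(fE _ _ g h uv) mulVg.
pose F (x : G) := ev a (repr x).
have FE w : F (\pi_G w) = ev a w by apply: ev_word_eq rel1 (word_eq_repr _ _).
exists F; split=> [x y|v g].
  rewrite -[x]reprK -[y]reprK -[_ * _]/(presented_mul _ _) presented_mulE.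
  by rewrite !FE ev_cat.
by rewrite -[vertex_elt g]/(\pi_G _) FE /= mulg1.
Qed.

Lemma graph_product_ext (M : groupType) (F F' : G -> M) :
    {morph F : x y / x * y} -> {morph F' : x y / x * y} ->
    (forall v (g : phi v), F (vertex_elt g) = F' (vertex_elt g)) ->
  F =1 F'.
Proof.
move=> FM FM' FF' x; apply: (@graph_product_gen [set x | F x = F' x]) => //.
split=> /= [|y z yE zE|y yE]; first by rewrite !morph_one.
  by rewrite FM FM' yE zE.
by rewrite !morph_inv // yE.
Qed.

End GraphProductTheory.

(** * Elimination of a simplicial vertex *)

Section Elimination.
Variables (V : finType) (E : rel V) (phi : V -> groupType) (v : V).
Hypothesis E_sym : symmetric E.
Hypothesis E_irr : irreflexive E.
Hypothesis phi_abelian : forall (u : V) (g h : phi u), commute g h.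
Hypothesis phi_fg : forall u, exists s : seq (phi u), gen [set` s] = [set: phi u].
Hypothesis v_simplicial : forall a b, E v a -> E v b -> a != b -> E a b.

Let V' := {u : V | u != v}.
Let E' : rel V' := relpre val E.
Let phi' (u : V') := phi (val u).
Let G := graph_product E phi.
Let H := graph_product E' phi'.

(** Vertices other than [v] are the elements of a subtype; this is the only place
    where families over the two kinds of vertices are glued, so that no transport
    along equalities of vertices appears later. *)
Lemma vertex_family (M : Type) (f0 : phi v -> M) (f1 : forall u : V', phi' u -> M) :
  exists f : forall u, phi u -> M, f v = f0 /\ forall u : V', f (val u) = f1 u.
Proof.
pose f u : phi u -> M := match pselect (v = u) with
  | left e => match e in _ = w return phi w -> M with erefl => f0 end
  | right n => f1 (exist _ u (introN eqP (fun e => n (esym e)))) end.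
exists f; rewrite /f; split=> [|[u p]] /=.
  by case: pselect => // e; rewrite (eq_irrelevance e erefl).
case: pselect => [e|n]; first by exfalso; move: (p); rewrite e eqxx.
by congr (f1 (exist _ u _)); apply: bool_irrelevance.
Qed.

Lemma elimination_ind (P : V -> Prop) :
  P v -> (forall u : V', P (val u)) -> forall u, P u.
Proof.
move=> Pv P' u; have [->//|uv] := eqVneq u v.
exact: (P' (exist (fun u => u != v) u uv)).
Qed.

Lemma elimination_lift (M : groupType) (f0 : phi v -> M)
    (f1 : forall u : V', phi' u -> M) :
    {morph f0 : g h / g * h} -> (forall u, {morph f1 u : g h / g * h}) ->
    (forall u w (g : phi' u) (h : phi' w), E' u w -> commute (f1 u g) (f1 w h)) ->
    (forall u g (h : phi' u), E v (val u) -> commute (f0 g) (f1 u h)) ->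
  exists F : G -> M, [/\ {morph F : x y / x * y},
    forall g : phi v, F (vertex_elt E g) = f0 g &
    forall u (g : phi' u), F (vertex_elt E (g : phi (val u))) = f1 u g].
Proof.
move=> M0 M1 C11 C01; have [f [fv fu]] := vertex_family f0 f1.
have [||F [FM FE]] := @graph_product_lift V E phi M f.
- apply: elimination_ind => [|u]; first by rewrite fv.
  rewrite fu; exact: M1.
- apply: elimination_ind => [|u]; apply: elimination_ind => [|w] g h.
  + by rewrite E_irr.
  + by rewrite fv fu; apply: C01.
  + by rewrite E_sym fv fu => vu; apply/commute_sym/C01.
  + by rewrite !fu; apply: C11.
by exists F; split=> // [g|u g]; rewrite FE ?fv ?fu.
Qed.

Hypothesis H_coherent : tuple_coherent H.

(** [iota] and [rho] make [H] a retract of [G].  The action [alpha] on reduced words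
    lets [H] permute the copies of the group of [v] and lets that group act
    through the copy of index [A]; elements of [A] fix that index, as the relations
    between [v] and its neighbours demand. *)
Theorem simplicial_elimination : tuple_coherent G.
Proof.
have [iota [iotaM iotaE]] : exists iota : H -> G, {morph iota : x y / x * y} /\
    forall u (g : phi' u), iota (vertex_elt E' g) = vertex_elt E (g : phi (val u)).
  apply: (@graph_product_lift V' E' phi' G
    (fun u (g : phi' u) => vertex_elt E (g : phi (val u)))).
    by move=> u g h; apply: vertex_eltM.
  by move=> u w g h; apply: (@vertex_elt_commute V E phi (val u) (val w)).
have [rho [rhoM rhov rhou]] : exists rho : G -> H, [/\ {morph rho : x y / x * y},
    forall g : phi v, rho (vertex_elt E g) = 1 &
    forall u (g : phi' u), rho (vertex_elt E (g : phi (val u))) = vertex_elt E' g].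
  apply: elimination_lift (fun=> 1) (fun u g => vertex_elt E' g) _ _ _ _.
  - by move=> g h; rewrite mulg1.
  - by move=> u g h; apply: vertex_eltM.
  - by move=> u w g h; apply: vertex_elt_commute.
  - by move=> u g h _; apply/commute_sym/commute1.
have iotaK x : rho (iota x) = x.
  apply: (@graph_product_ext _ _ _ _ (rho \o iota) id) => //.
    by move=> y z; rewrite /= iotaM rhoM.
  by move=> u g; rewrite /= iotaE rhou.
pose A : set H := gen [set x | exists u (g : phi' u), E v (val u) /\ x = vertex_elt E' g].
have AS : is_subgroup A by apply: gen_subgroup.
have Agen u (g : phi' u) : E v (val u) -> A (vertex_elt E' g).
  by move=> vu; apply: sub_gen; exists u, g.
have [tr [trM trE]] := action_bijection (@rword_relabel_action H (phi v)).
have [bm [bmM bmE]] := action_bijection (@rword_lmul_action H (phi v) A).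
have [alpha [alphaM alphav alphau]] : exists alpha : G -> bijection (rword H (phi v)),
    [/\ {morph alpha : x y / x * y},
      forall g : phi v, alpha (vertex_elt E g) = bm g &
      forall u (g : phi' u), alpha (vertex_elt E (g : phi (val u))) = tr (vertex_elt E' g)].
  apply: (@elimination_lift _ bm (fun u g => tr (vertex_elt E' g))) => //.
  - by move=> u g h; rewrite vertex_eltM trM.
  - by move=> u w g h uw; rewrite /commute -!trM; congr tr; apply: vertex_elt_commute.
  - move=> u g h vu; apply: bijectionP => p; rewrite /= !trE !bmE; apply: val_inj.
    by rewrite /= relabel_lmul //; apply: Agen.
have alpha_iota h : alpha (iota h) = tr h.
  apply: (@graph_product_ext _ _ _ _ (alpha \o iota) tr) => //.
    by move=> y z; rewrite /= iotaM alphaM.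
  by move=> u g; rewrite /= iotaE alphau.
(* C is abelian since v is simplicial. *)
pose star u := (u == v) || E v u.
have [gens gensP] : exists gens : forall u, seq (phi u),
    forall u, gen [set` gens u] = [set: phi u].
  by exists (fun u => sval (cid (phi_fg u))) => u; case: cid.
pose s := flatten [seq map (@vertex_elt V E phi u) (gens u) | u <- enum V & star u].
pose C := gen [set` s].
have CS : is_subgroup C by apply: gen_subgroup.
have cs : {in s &, forall x y, commute x y}.
  have sP x : x \in s -> exists u (g : phi u), star u /\ x = vertex_elt E g.
    case/flattenP=> _ /mapP[u + ->] /mapP[g _ ->].
    by rewrite mem_filter => /andP[su _]; exists u, g.
  move=> _ _ /sP[u [g [su ->]]] /sP[w [h [sw ->]]].
  have [uw|uw] := eqVneq u w.
    by subst w; rewrite /commute -!vertex_eltM phi_abelian.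
  apply: vertex_elt_commute; move: su sw uw; rewrite /star.
  case: eqVneq => [-> _|uv /= vu]; first by case: eqVneq => [->|]; rewrite ?eqxx.
  case: eqVneq => [-> _|wv /= vw]; first by rewrite E_sym.
  exact: v_simplicial.
have Cstar u (g : phi u) : star u -> C (vertex_elt E g).
  move=> su; have : gen [set` gens u] g by rewrite gensP.
  apply: (@gen_morph _ _ (@vertex_elt V E phi u) [set` gens u] [set` s]).
    exact: vertex_eltM.
  move=> x xu; apply: sub_gen; apply/flattenP.
  exists (map (@vertex_elt V E phi u) (gens u)); last exact: map_f.
  by apply: map_f; rewrite mem_filter su mem_enum.
have iotaA a : A a -> C (iota a).
  apply: (@gen_morph _ _ iota) => //.
  by move=> _ [u [g [vu ->]]]; rewrite iotaE; apply: Cstar; rewrite /star vu orbT.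
pose Hs : set G := range iota.
have HsS : is_subgroup Hs.
  split=> [|_ _ [x _ <-] [y _ <-]|_ [x _ <-]].
  - by exists 1 => //; apply: morph_one.
  - by exists (x * y); rewrite ?iotaM.
  - by exists x^-1; rewrite ?morph_inv.
have [C1 CM CV] := CS; have [A1 AM AV] := AS.
have iota1 : iota 1 = 1 := morph_one iotaM.
have velt1 : vertex_elt E (1 : phi v) = 1 := morph_one (@vertex_eltM V E phi v).
have Csplit c : C c -> exists (g : phi v) a, A a /\ c = vertex_elt E g * iota a.
  have Cv (g : phi v) : C (vertex_elt E g) by apply: Cstar; rewrite /star eqxx.
  have cCC := gen_commute (A := [set` s]) cs.
  apply: (@gen_sub _ [set` s]
    [set c | exists (g : phi v) a, A a /\ c = vertex_elt E g * iota a]).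
    split.
    - by exists 1, 1; split=> //; rewrite iota1 velt1 mulg1.
    - move=> _ _ [g [a [Aa ->]]] [h [b [Ab ->]]].
      exists (g * h), (a * b); split; first exact: AM.
      rewrite vertex_eltM iotaM !mulgA; congr (_ * _); rewrite -!mulgA; congr (_ * _).
      by apply: cCC; [apply: iotaA|apply: Cv].
    - move=> _ [g [a [Aa ->]]]; exists g^-1, a^-1; split; first exact: AV.
      rewrite invgM -(morph_inv iotaM) -(morph_inv (@vertex_eltM V E phi v)).
      by apply: cCC; [by apply: iotaA; apply: AV|apply: Cv].
  move=> x /flattenP[_ /mapP[u + ->] /mapP[g _ ->]]; rewrite mem_filter => /andP[+ _].
  move: u g; apply: elimination_ind => [|u] g su.
    by exists g, 1; rewrite iota1 mulg1.
  exists 1, (vertex_elt E' (g : phi' u)); split.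
    by apply: Agen; move: su; rewrite /star (negPf (svalP u)).
  by rewrite iotaE velt1 mul1g.
have red0 : reduced ([::] : seq (set H * phi v)) by [].
pose eps : rword H (phi v) := exist _ [::] red0.
pose act (g : G) (p : rword H (phi v)) := alpha g p.
pose Y : set (rword H (phi v)) := [set p | starts A (val p)].
apply: (@amalgam_tuple_coherent G Hs C (rword H (phi v)) act eps Y) => //.
- move=> g; have [g1 gM gV] := gen_subgroup (Hs `|` C).
  apply: graph_product_gen; first exact: gen_subgroup.
  apply: elimination_ind => [|u] h; apply: sub_gen; last first.
    by left; exists (vertex_elt E' (h : phi' u)).
  by right; apply: Cstar; rewrite /star eqxx.
- split=> [p|g h p]; rewrite /act; first by rewrite (morph_one alphaM).
  by rewrite alphaM.
- by move=> _ [h _ <-]; rewrite /act alpha_iota trE; apply: val_inj.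
- move=> c p Cc nHc /negP np; have [g [a [Aa cE]]] := Csplit c Cc.
  have g1 : g != 1.
    apply: contra_notN nHc => /eqP g1; exists a => //.
    by rewrite cE g1 velt1 mul1g.
  rewrite /act cE alphaM alphav alpha_iota /= bmE trE /Y /=.
  by apply: starts_lmul => //; rewrite starts_relabelA.
- move=> _ p [h _ <-] nCh Yp; rewrite /act alpha_iota trE /Y /= starts_relabel //.
  by move/asboolP/iotaA.
- move=> n a aH; apply: (fin_related_inj (f := rho)) (H_coherent _).
  + exact: rhoM.
  + move=> x /(gen_sub HsS) [|y _ <-]; first by move=> _ [i _ <-]; apply: aH.
    by rewrite iotaK => ->; apply: morph_one.
- by exists s.
Qed.

End Elimination.

(** * Coherence of chordal graph products *)

Lemma induced_cycle_map (U V : finType) (f : U -> V) (E : rel V) (c : seq U) :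
  injective f -> induced_cycle (relpre f E) c -> induced_cycle E (map f c).
Proof.
move=> f_inj [c2 cu cE]; split; rewrite ?size_map ?map_inj_uniq //.
move=> _ _ /mapP[x xc ->] /mapP[y yc ->].
by rewrite !next_map // !inj_eq //; apply: cE.
Qed.

Theorem chordal_graph_product_tuple_coherent (V : finType) (E : rel V)
    (phi : V -> groupType) :
    symmetric E -> irreflexive E ->
    (forall v (g h : phi v), commute g h) ->
    (forall v, exists s : seq (phi v), gen [set` s] = [set: phi v]) ->
    (forall c : seq V, induced_cycle E c -> ~ (3 < size c)%N) ->
  tuple_coherent (graph_product E phi).
Proof.
have [n] := ubnP #|V|; elim: n V E phi => // n IHn V E phi.
rewrite ltnS => Vn Esym Eirr phiC phi_fg chordal.
have [[v0]|V0] := pselect (inhabited V); last first.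
  have G1 (x : graph_product E phi) : x = 1.
    apply: (@graph_product_gen V E phi [set x | x = 1]) => [|v].
      by split=> [|y z -> ->|y ->] //=; rewrite ?mulg1 ?invg1.
    by case: V0.
  by move=> k a; apply: fin_related_abelian => i j; rewrite [a i]G1 [a j]G1.
have [v vs] := simplicial_vertex Esym Eirr chordal v0.
apply: (@simplicial_elimination V E phi v) => //.
apply: IHn => //.
- have V_gt0 : 0 < #|V| by apply/card_gt0P; exists v.
  by rewrite card_sig [#|_|](cardC1 v) (leq_trans _ Vn) // prednK.
- by move=> a b; apply: Esym.
- by move=> a; apply: Eirr.
- move=> c /(induced_cycle_map val_inj)/chordal; rewrite size_map; exact.
Qed.

Theorem theoremA (V : finType) (E : rel V)
    (E_sym : symmetric E) (E_irr : irreflexive E) (V_neq0 : 0 < #|V|)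
    (phi : V -> groupType)
    (phi_abelian : forall (v : V) (g h : phi v), commute g h)
    (phi_nontrivial : forall v : V, exists g : phi v, g <> 1%g)
    (phi_fg : forall v : V, finitely_generated (phi v))
    (no_long_induced_cycle : forall c : seq V,
        induced_cycle E c -> ~ (3 < size c)) :
  coherent (graph_product E phi).
Proof.
apply: tuple_coherent_coherent.
apply: chordal_graph_product_tuple_coherent => // v.
exact: finitely_generated_gen.
Qed.
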